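(* Let $B,F$ be 1-cells over a 0-cell $\mathcal A$ of a 2-category $\mathcal K$ (all notions are defined in the context; $\eta_M=\eta_F\otimes\eta_B$, $\varepsilon'_C=\varepsilon_F\otimes\varepsilon_B$). (1) Set $\psi_1=(l\otimes B)\circ(B\otimes\tau_{B,F})\circ(\Delta_B\otimes F)$ (that is, $r$ is trivial). If $(B,F)$ is a monad Hopf datum with $r$ trivial and $\psi=\psi_1$, $\sigma$ is trivial, $\Delta_B\circ m_B=(m_B\otimes m_B)\circ(B\otimes\tau_{B,B}\otimes B)\circ(\Delta_B\otimes\Delta_B)$ and $\tau_{B,F}\circ(B\otimes l)=(l\otimes B)\circ(B\otimes\tau_{B,F})\circ(\tau_{B,B}\otimes F)$, then $(F,\psi_1,\mu_M,\eta_M)$ with $\mu_M$ canonical, i.e. $\mu_M=m_F\otimes\eta_B$, is a left wreath around $B$. (2) Set $\psi_2=(F\otimes r)\circ(\tau_{B,F}\otimes F)\circ(B\otimes\Delta_F)$ (that is, $l$ is trivial). If $(B,F)$ is a monad Hopf datum with $l$ trivial and $\psi=\psi_2$, $(F,\Delta_F,\varepsilon_F)$ is a comonad, and $\Delta_F\circ m_F=(m_F\otimes m_F)\circ(F\otimes\tau_{F,F}\otimes F)\circ(\Delta_F\otimes\Delta_F)$, $(F\otimes\tau_{B,F})\circ(\tau_{B,F}\otimes F)\circ(B\otimes\tau_{F,F})=(\tau_{F,F}\otimes B)\circ(F\otimes\tau_{B,F})\circ(\tau_{B,F}\otimes F)$, $\tau_{B,F}\circ(r\otimes F)=(F\otimes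 r)\circ(\tau_{B,F}\otimes F)\circ(B\otimes\tau_{F,F})$, $(F\otimes\tau_{F,F})\circ(\tau_{F,F}\otimes F)\circ(F\otimes\tau_{F,F})=(\tau_{F,F}\otimes F)\circ(F\otimes\tau_{F,F})\circ(\tau_{F,F}\otimes F)$, $\tau_{B,F}\circ(\sigma\otimes F)=(F\otimes\sigma)\circ(\tau_{F,F}\otimes F)\circ(F\otimes\tau_{F,F})$, then $(F,\psi_2,\mu_M,\eta_M)$ is a left wreath around $B$. (3) Set $\phi'_1=(B\otimes m_F)\circ(\tau_{F,B}\otimes F)\circ(F\otimes c)$ (that is, $d$ is trivial). If $(B,F)$ is a comonad Hopf datum with $d$ trivial and $\phi'=\phi'_1$, $\rho'$ is trivial, $\Delta_F\circ m_F=(m_F\otimes m_F)\circ(F\otimes\tau_{F,F}\otimes F)\circ(\Delta_F\otimes\Delta_F)$ and $(c\otimes F)\circ\tau_{F,B}=(B\otimes\tau_{F,F})\circ(\tau_{F,B}\otimes F)\circ(F\otimes c)$, then $(B,\phi'_1,\Delta'_C,\varepsilon'_C)$ with $\Delta'_C$ canonical, i.e. $\Delta'_C=\varepsilon_F\otimes\Delta_B$, is a right cowreath around $F$. (4) Set $\phi'_2=(m_B\otimes F)\circ(B\otimes\tau_{F,B})\circ(d\otimes B)$ (that is, $c$ is trivial). If $(B,F)$ is a comonad Hopf datum with $c$ trivial and $\phi'=\phi'_2$, $(B,m_B,\eta_B)$ is a monad, and $\Delta_B\circ m_B=(m_B\otimes m_B)\circ(B\otimes\tau_{B,B}\otimes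 B)\circ(\Delta_B\otimes\Delta_B)$, $(\tau_{B,B}\otimes F)\circ(B\otimes\tau_{F,B})\circ(\tau_{F,B}\otimes B)=(B\otimes\tau_{F,B})\circ(\tau_{F,B}\otimes B)\circ(F\otimes\tau_{B,B})$, $(B\otimes d)\circ\tau_{F,B}=(\tau_{B,B}\otimes F)\circ(B\otimes\tau_{F,B})\circ(d\otimes B)$, $(B\otimes\tau_{B,B})\circ(\tau_{B,B}\otimes B)\circ(B\otimes\tau_{B,B})=(\tau_{B,B}\otimes B)\circ(B\otimes\tau_{B,B})\circ(\tau_{B,B}\otimes B)$, $(B\otimes\rho')\circ\tau_{F,B}=(\tau_{B,B}\otimes B)\circ(B\otimes\tau_{B,B})\circ(\rho'\otimes B)$, then $(B,\phi'_2,\Delta'_C,\varepsilon'_C)$ is a right cowreath around $F$.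
   Context: CONVENTIONS. Fix a 2-category $\mathcal K$ and a 0-cell $\mathcal A$. All 1-cells are 1-cells $\mathcal A\to\mathcal A$; $XY$ is the composite of 1-cells and $1=\mathrm{id}_{\mathcal A}$. For 2-cells, $\circ$ is vertical composition ($g\circ f$: first $f$, then $g$) and $\otimes$ is horizontal composition, with left-to-right order matching the order of letters in $XY$; a 1-cell also denotes its identity 2-cell. So all identities live in the strict monoidal category $\mathcal K(\mathcal A,\mathcal A)$, and monads/comonads are monoids/comonoids there. DISTRIBUTIVE LAWS. For 1-cells $X,Y$ equipped with 2-cells $m_X:XX\to X$, $\eta_X:1\to X$, $\Delta_X:X\to XX$, $\varepsilon_X:X\to 1$ and similarly for $Y$, a 2-cell $\tau:XY\to YX$ is a left and right monadic and comonadic distributive law if $\tau\circ(m_X\otimes Y)=(Y\otimes m_X)\circ(\tau\otimes X)\circ(X\otimes\tau)$, $\tau\circ(\eta_X\otimes Y)=Y\otimes\eta_X$; $\tau\circ(X\otimes m_Y)=(m_Y\otimes X)\circ(Y\otimes\tau)\circ(\tau\otimes Y)$, $\tau\circ(X\otimes\eta_Y)=\eta_Y\otimes X$; $(Y\otimes\tau)\circ(\tau\otimes Y)\circ(X\otimes\Delta_Y)=(\Delta_Y\otimes X)\circ\tau$, $(\varepsilon_Y\otimes X)\circ\tau=X\otimes\varepsilon_Y$; $(\tau\otimes X)\circ(X\otimes\tau)\circ(\Delta_X\otimes Y)=(Y\otimes\Delta_X)\circ\tau$, $(Y\otimes\varepsilon_X)\circ\tau=\varepsilon_X\otimes Y$.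 LEFT WREATH. For a monad $B$, $(F,\psi:BF\to FB,\mu_M:FF\to FB,\eta_M:1\to FB)$ is a left wreath around $B$ if $\psi\circ(m_B\otimes F)=(F\otimes m_B)\circ(\psi\otimes B)\circ(B\otimes\psi)$, $\psi\circ(\eta_B\otimes F)=F\otimes\eta_B$; $(F\otimes m_B)\circ(\mu_M\otimes B)\circ(F\otimes\psi)\circ(\psi\otimes F)=(F\otimes m_B)\circ(\psi\otimes B)\circ(B\otimes\mu_M)$; $(F\otimes m_B)\circ(\eta_M\otimes B)=(F\otimes m_B)\circ(\psi\otimes B)\circ(B\otimes\eta_M)$; $(F\otimes m_B)\circ(\mu_M\otimes B)\circ(F\otimes\mu_M)=(F\otimes m_B)\circ(\mu_M\otimes B)\circ(F\otimes\psi)\circ(\mu_M\otimes F)$; $(F\otimes m_B)\circ(\mu_M\otimes B)\circ(F\otimes\psi)\circ(\eta_M\otimes F)=F\otimes\eta_B=(F\otimes m_B)\circ(\mu_M\otimes B)\circ(F\otimes\eta_M)$. RIGHT COWREATH. For a comonad $F$, $(B,\phi':FB\to BF,\Delta'_C:FB\to BB,\varepsilon'_C:FB\to 1)$ is a right cowreath around $F$ if $(\phi'\otimes F)\circ(F\otimes\phi')\circ(\Delta_F\otimes B)=(B\otimes\Delta_F)\circ\phi'$, $(B\otimes\varepsilon_F)\circ\phi'=\varepsilon_F\otimes B$; $(\Delta'_C\otimes F)\circ(F\otimes\phi')\circ(\Delta_F\otimes B)=(B\otimes\phi')\circ(\phi'\otimes B)\circ(F\otimes\Delta'_C)\circ(\Delta_F\otimes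 B)$; $(\varepsilon'_C\otimes F)\circ(F\otimes\phi')\circ(\Delta_F\otimes B)=(F\otimes\varepsilon'_C)\circ(\Delta_F\otimes B)$; $(B\otimes\Delta'_C)\circ(\phi'\otimes B)\circ(F\otimes\Delta'_C)\circ(\Delta_F\otimes B)=(\Delta'_C\otimes B)\circ(F\otimes\Delta'_C)\circ(\Delta_F\otimes B)$; $(B\otimes\varepsilon'_C)\circ(\phi'\otimes B)\circ(F\otimes\Delta'_C)\circ(\Delta_F\otimes B)=\varepsilon_F\otimes B=(\varepsilon'_C\otimes B)\circ(F\otimes\Delta'_C)\circ(\Delta_F\otimes B)$. MONAD HOPF DATUM. A monad Hopf datum $(B,F)$ consists of a monad $(B,m_B,\eta_B)$ and a 1-cell $F$ over $\mathcal A$, with 2-cells $\Delta_B:B\to BB$, $\varepsilon_B:B\to1$, $m_F:FF\to F$, $\eta_F:1\to F$, $\Delta_F:F\to FF$, $\varepsilon_F:F\to 1$ such that for $X=B,F$: $\varepsilon_X\circ m_X=\varepsilon_X\otimes\varepsilon_X$, $\Delta_X\circ\eta_X=\eta_X\otimes\eta_X$, $\varepsilon_X\circ\eta_X=\mathrm{id}_1$; 2-cells $l:BF\to F$, making $F$ a left $B$-module, and $r:BF\to B$, with $\varepsilon_F\circ l=\varepsilon_B\otimes\varepsilon_F$, $\varepsilon_B\circ r=\varepsilon_B\otimes\varepsilon_F$; a 2-cell $\sigma:FF\to B$ and left and right monadic and comonadic distributive laws $\tau_{X,Y}:XY\to YX$, $X,Y\in\{B,F\}$ (with respect to the 2-cells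 $m_B,\eta_B,\Delta_B,\varepsilon_B$ on $B$ and $m_F,\eta_F,\Delta_F,\varepsilon_F$ on $F$); such that, setting $\eta_M=\eta_F\otimes\eta_B$, $\psi=(l\otimes r)\circ(B\otimes\tau_{B,F}\otimes F)\circ(\Delta_B\otimes\Delta_F)$, $\mu_M=(m_F\otimes\sigma)\circ(F\otimes\tau_{F,F}\otimes F)\circ(\Delta_F\otimes\Delta_F)$, the following hold: $m_F\circ(F\otimes l)\circ(\psi\otimes F)=l\circ(B\otimes m_F)$, $l\circ(B\otimes\eta_F)=\eta_F\circ\varepsilon_B$; $m_F\circ(F\otimes m_F)=m_F\circ(F\otimes l)\circ(\mu_M\otimes F)$, $m_F\circ(F\otimes l)\circ(\eta_M\otimes F)=F=m_F\circ(F\otimes\eta_F)$; $m_B\circ(r\otimes B)\circ(B\otimes\psi)=r\circ(m_B\otimes F)$, $r\circ(\eta_B\otimes F)=\eta_B\circ\varepsilon_F$; $m_B\circ(\sigma\otimes B)\circ(F\otimes\psi)\circ(\psi\otimes F)=m_B\circ(r\otimes B)\circ(B\otimes\mu_M)$, $m_B\circ(\varepsilon_F\otimes BB)\circ(\eta_M\otimes B)=m_B\circ(r\otimes B)\circ(B\otimes\eta_M)$; $m_B\circ(\sigma\otimes B)\circ(F\otimes\mu_M)=m_B\circ(\sigma\otimes B)\circ(F\otimes\psi)\circ(\mu_M\otimes F)$, $m_B\circ(\sigma\otimes B)\circ(F\otimes\psi)\circ(\eta_M\otimes F)=\eta_B\circ\varepsilon_F=m_B\circ(\sigma\otimes B)\circ(F\otimes\eta_M)$;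 $\varepsilon_B\circ\sigma=\varepsilon_F\otimes\varepsilon_F$. COMONAD HOPF DATUM. This is the dual notion: a comonad $(F,\Delta_F,\varepsilon_F)$ and a 1-cell $B$ over $\mathcal A$ with 2-cells $m_F,\eta_F,m_B,\eta_B,\Delta_B,\varepsilon_B$ satisfying for $X=B,F$: $\varepsilon_X\circ m_X=\varepsilon_X\otimes\varepsilon_X$, $\Delta_X\circ\eta_X=\eta_X\otimes\eta_X$, $\varepsilon_X\circ\eta_X=\mathrm{id}_1$; 2-cells $c:B\to BF$, making $B$ a right $F$-comodule, and $d:F\to BF$, with $c\circ\eta_B=\eta_B\otimes\eta_F$, $d\circ\eta_F=\eta_B\otimes\eta_F$; a 2-cell $\rho':F\to BB$ and left and right monadic and comonadic distributive laws $\tau_{X,Y}:XY\to YX$, $X,Y\in\{B,F\}$; such that, setting $\varepsilon'_C=\varepsilon_F\otimes\varepsilon_B$, $\phi'=(m_B\otimes m_F)\circ(B\otimes\tau_{F,B}\otimes F)\circ(d\otimes c)$, $\Delta'_C=(m_B\otimes m_B)\circ(B\otimes\tau_{B,B}\otimes B)\circ(\rho'\otimes\Delta_B)$, the following hold: $(B\otimes\phi')\circ(c\otimes B)\circ\Delta_B=(\Delta_B\otimes F)\circ c$, $(\varepsilon_B\otimes F)\circ c=\eta_F\circ\varepsilon_B$; $(\Delta_B\otimes B)\circ\Delta_B=(B\otimes\Delta'_C)\circ(c\otimes B)\circ\Delta_B$, $(B\otimes\varepsilon'_C)\circ(c\otimes B)\circ\Delta_B=B=(\varepsilon_B\otimes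 B)\circ\Delta_B$; $(\phi'\otimes F)\circ(F\otimes d)\circ\Delta_F=(B\otimes\Delta_F)\circ d$, $(B\otimes\varepsilon_F)\circ d=\eta_B\circ\varepsilon_F$; $(\Delta'_C\otimes F)\circ(F\otimes d)\circ\Delta_F=(B\otimes\phi')\circ(\phi'\otimes B)\circ(F\otimes\rho')\circ\Delta_F$, $(\varepsilon'_C\otimes F)\circ(F\otimes d)\circ\Delta_F=(F\otimes\varepsilon'_C)\circ(\Delta_F\otimes\eta_B)$; $(B\otimes\Delta'_C)\circ(\phi'\otimes B)\circ(F\otimes\rho')\circ\Delta_F=(\Delta'_C\otimes B)\circ(F\otimes\rho')\circ\Delta_F$, $(B\otimes\varepsilon'_C)\circ(\phi'\otimes B)\circ(F\otimes\rho')\circ\Delta_F=\eta_B\circ\varepsilon_F=(\varepsilon'_C\otimes B)\circ(F\otimes\rho')\circ\Delta_F$; $\rho'\circ\eta_F=\eta_B\otimes\eta_B$. TRIVIAL 2-CELLS. $l$ is trivial if $l=\varepsilon_B\otimes F$; $r$ if $r=B\otimes\varepsilon_F$; $c$ if $c=B\otimes\eta_F$; $d$ if $d=\eta_B\otimes F$; $\sigma$ if $\sigma=\eta_B\circ(\varepsilon_F\otimes\varepsilon_F)$; $\rho'$ if $\rho'=(\eta_B\otimes\eta_B)\circ\varepsilon_F$.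
   Formalization: Part (1) additionally assumes that Δ_B is coassociative, and part (3) that m_F is associative; without these the two parts are false (B = functions on a non-associative unital magma acting on a graded algebra F, and dually). *)

(* Defs.v *)
From Stdlib Require Import List.
Import ListNotations.

Set Implicit Arguments.
Unset Strict Implicit.
Unset Printing Implicit Defensive.

Definition transport2 {T : Type} {H : T -> T -> Type} {x x' y y' : T}
    (p : x = x') (q : y = y') (h : H x y) : H x' y' :=
  match p in _ = x0, q in _ = y0 return H x0 y0 with
  | eq_refl, eq_refl => h
  end.

(* Strict 2-categories.  [comp1 X Y] is the composite [XY] (first [Y], then
   [X]), [vcomp g f] is "first [f], then [g]", and [hcomp] follows the order of
   the letters in [comp1].  The composition of 1-cells is strictly associative
   and unital; the corresponding laws of [hcomp] are stated up to transport
   along these equalities of 1-cells. *)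
Record TwoCategory : Type := {
  cell0 :> Type;
  cell1 : cell0 -> cell0 -> Type;
  cell2 : forall a b : cell0, cell1 a b -> cell1 a b -> Type;
  id1 : forall a : cell0, cell1 a a;
  comp1 : forall a b c : cell0, cell1 b c -> cell1 a b -> cell1 a c;
  id2 : forall (a b : cell0) (X : cell1 a b), cell2 X X;
  vcomp : forall (a b : cell0) (X Y Z : cell1 a b),
    cell2 Y Z -> cell2 X Y -> cell2 X Z;
  hcomp : forall (a b c : cell0) (X X' : cell1 b c) (Y Y' : cell1 a b),
    cell2 X X' -> cell2 Y Y' -> cell2 (comp1 X Y) (comp1 X' Y');
  comp1A : forall (a b c d : cell0)
    (X : cell1 c d) (Y : cell1 b c) (Z : cell1 a b),
    comp1 X (comp1 Y Z) = comp1 (comp1 X Y) Z;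
  comp1_id1l : forall (a b : cell0) (X : cell1 a b), comp1 (id1 b) X = X;
  comp1_id1r : forall (a b : cell0) (X : cell1 a b), comp1 X (id1 a) = X;
  vcompA : forall (a b : cell0) (X Y Z W : cell1 a b)
    (h : cell2 Z W) (g : cell2 Y Z) (f : cell2 X Y),
    vcomp h (vcomp g f) = vcomp (vcomp h g) f;
  vcomp_id2l : forall (a b : cell0) (X Y : cell1 a b) (f : cell2 X Y),
    vcomp (id2 Y) f = f;
  vcomp_id2r : forall (a b : cell0) (X Y : cell1 a b) (f : cell2 X Y),
    vcomp f (id2 X) = f;
  hcomp_id2 : forall (a b c : cell0) (X : cell1 b c) (Y : cell1 a b),
    hcomp (id2 X) (id2 Y) = id2 (comp1 X Y);
  hcomp_vcomp : forall (a b c : cell0)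
    (X X' X'' : cell1 b c) (Y Y' Y'' : cell1 a b)
    (g : cell2 X' X'') (f : cell2 X X') (g' : cell2 Y' Y'') (f' : cell2 Y Y'),
    hcomp (vcomp g f) (vcomp g' f') = vcomp (hcomp g g') (hcomp f f');
  hcompA : forall (a b c d : cell0) (X X' : cell1 c d) (Y Y' : cell1 b c)
    (Z Z' : cell1 a b) (f : cell2 X X') (g : cell2 Y Y') (h : cell2 Z Z'),
    transport2 (comp1A X Y Z) (comp1A X' Y' Z') (hcomp f (hcomp g h))
    = hcomp (hcomp f g) h;
  hcomp_id1l : forall (a b : cell0) (X X' : cell1 a b) (f : cell2 X X'),
    transport2 (comp1_id1l X) (comp1_id1l X') (hcomp (id2 (id1 b)) f) = f;
  hcomp_id1r : forall (a b : cell0) (X X' : cell1 a b) (f : cell2 X X'),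
    transport2 (comp1_id1r X) (comp1_id1r X') (hcomp f (id2 (id1 a))) = f
}.

Arguments cell1 {t} _ _.
Arguments cell2 {t a b} _ _.
Arguments id1 {t} a.
Arguments comp1 {t a b c} _ _.
Arguments id2 {t a b} X.
Arguments vcomp {t a b X Y Z} _ _.
Arguments hcomp {t a b c X X' Y Y'} _ _.

(* The strict monoidal category of 1-cells A -> A.  A composite XY...Z is
   represented by the word [X; Y; ...; Z] of its letters, so that composites of
   composites of given 1-cells have convertible types and no transport along
   [comp1A] is visible in equations between 2-cells. *)
Section Words.
Context {K : TwoCategory} {A : K}.

Fixpoint composite (w : list (cell1 A A)) : cell1 A A :=
  match w with
  | [] => id1 A
  | [X] => X
  | X :: w' => comp1 X (composite w')
  end.

Definition cell (u v : list (cell1 A A)) : Type :=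
  cell2 (composite u) (composite v).

Lemma composite_cons (X : cell1 A A) (w : list (cell1 A A)) :
  comp1 X (composite w) = composite (X :: w).
Proof. destruct w as [|Y w]; [exact (comp1_id1r X) | reflexivity]. Defined.

Lemma composite_app (u v : list (cell1 A A)) :
  comp1 (composite u) (composite v) = composite (u ++ v).
Proof.
induction u as [|X u IH]; [exact (comp1_id1l _)|].
destruct u as [|Y u]; [exact (composite_cons X v)|].
exact (eq_trans (eq_sym (comp1A _ _ _)) (f_equal (comp1 X) IH)).
Defined.

Definition idw (w : list (cell1 A A)) : cell w w := id2 (composite w).

Definition vert {u v w : list (cell1 A A)} (g : cell v w) (f : cell u v) :
  cell u w := vcomp g f.

Definition tens {u u' v v' : list (cell1 A A)} (f : cell u u') (g : cell v v') :
    cell (u ++ v) (u' ++ v') :=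
  transport2 (composite_app u v) (composite_app u' v') (hcomp f g).

End Words.

Declare Scope cell_scope.
Delimit Scope cell_scope with cell.
Notation "g ∘ f" := (vert g f) (at level 40, left associativity) : cell_scope.
Notation "f ⊗ g" := (tens f g) (at level 36, left associativity) : cell_scope.
Open Scope cell_scope.

Section Notions.
Context {K : TwoCategory} {A : K}.
Implicit Types X Y B F : cell1 A A.

Record StructureCells (X : cell1 A A) : Type := {
  mul : cell [X; X] [X];
  unit : cell [] [X];
  comul : cell [X] [X; X];
  counit : cell [X] []
}.

Definition is_monad X (m : cell [X; X] [X]) (η : cell [] [X]) : Prop :=
  m ∘ (m ⊗ idw [X]) = m ∘ (idw [X] ⊗ m)
  /\ m ∘ (η ⊗ idw [X]) = idw [X]
  /\ m ∘ (idw [X] ⊗ η) = idw [X].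

Definition is_comonad X (Δ : cell [X] [X; X]) (ε : cell [X] []) : Prop :=
  (Δ ⊗ idw [X]) ∘ Δ = (idw [X] ⊗ Δ) ∘ Δ
  /\ (ε ⊗ idw [X]) ∘ Δ = idw [X]
  /\ (idw [X] ⊗ ε) ∘ Δ = idw [X].

Definition is_left_module B F (m : cell [B; B] [B]) (η : cell [] [B])
    (l : cell [B; F] [F]) : Prop :=
  l ∘ (m ⊗ idw [F]) = l ∘ (idw [B] ⊗ l)
  /\ l ∘ (η ⊗ idw [F]) = idw [F].

Definition is_right_comodule B F (Δ : cell [F] [F; F]) (ε : cell [F] [])
    (c : cell [B] [B; F]) : Prop :=
  (c ⊗ idw [F]) ∘ c = (idw [B] ⊗ Δ) ∘ c
  /\ (idw [B] ⊗ ε) ∘ c = idw [B].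

(* No (co)associativity or (co)unitality of X and Y is presupposed. *)
Definition is_distributive_law X Y (x : StructureCells X) (y : StructureCells Y)
    (τ : cell [X; Y] [Y; X]) : Prop :=
  (τ ∘ (mul x ⊗ idw [Y])
     = (idw [Y] ⊗ mul x) ∘ (τ ⊗ idw [X]) ∘ (idw [X] ⊗ τ)
   /\ τ ∘ (unit x ⊗ idw [Y]) = idw [Y] ⊗ unit x)
  /\ (τ ∘ (idw [X] ⊗ mul y)
        = (mul y ⊗ idw [X]) ∘ (idw [Y] ⊗ τ) ∘ (τ ⊗ idw [Y])
      /\ τ ∘ (idw [X] ⊗ unit y) = unit y ⊗ idw [X])
  /\ ((idw [Y] ⊗ τ) ∘ (τ ⊗ idw [Y]) ∘ (idw [X] ⊗ comul y)
        = (comul y ⊗ idw [X]) ∘ τ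
      /\ (counit y ⊗ idw [X]) ∘ τ = idw [X] ⊗ counit y)
  /\ ((τ ⊗ idw [X]) ∘ (idw [X] ⊗ τ) ∘ (comul x ⊗ idw [Y])
        = (idw [Y] ⊗ comul x) ∘ τ
      /\ (idw [Y] ⊗ counit x) ∘ τ = counit x ⊗ idw [Y]).

Definition is_left_wreath B (m : cell [B; B] [B]) (η : cell [] [B]) F
    (ψ : cell [B; F] [F; B]) (μM : cell [F; F] [F; B]) (ηM : cell [] [F; B]) :
    Prop :=
  (ψ ∘ (m ⊗ idw [F]) = (idw [F] ⊗ m) ∘ (ψ ⊗ idw [B]) ∘ (idw [B] ⊗ ψ)
   /\ ψ ∘ (η ⊗ idw [F]) = idw [F] ⊗ η)
  /\ (idw [F] ⊗ m) ∘ (μM ⊗ idw [B]) ∘ (idw [F] ⊗ ψ) ∘ (ψ ⊗ idw [F])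
     = (idw [F] ⊗ m) ∘ (ψ ⊗ idw [B]) ∘ (idw [B] ⊗ μM)
  /\ (idw [F] ⊗ m) ∘ (ηM ⊗ idw [B])
     = (idw [F] ⊗ m) ∘ (ψ ⊗ idw [B]) ∘ (idw [B] ⊗ ηM)
  /\ (idw [F] ⊗ m) ∘ (μM ⊗ idw [B]) ∘ (idw [F] ⊗ μM)
     = (idw [F] ⊗ m) ∘ (μM ⊗ idw [B]) ∘ (idw [F] ⊗ ψ) ∘ (μM ⊗ idw [F])
  /\ ((idw [F] ⊗ m) ∘ (μM ⊗ idw [B]) ∘ (idw [F] ⊗ ψ) ∘ (ηM ⊗ idw [F])
        = idw [F] ⊗ η
      /\ (idw [F] ⊗ m) ∘ (μM ⊗ idw [B]) ∘ (idw [F] ⊗ ηM) = idw [F] ⊗ η).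

Definition is_right_cowreath F (Δ : cell [F] [F; F]) (ε : cell [F] []) B
    (φ : cell [F; B] [B; F]) (ΔC : cell [F; B] [B; B]) (εC : cell [F; B] []) :
    Prop :=
  ((φ ⊗ idw [F]) ∘ (idw [F] ⊗ φ) ∘ (Δ ⊗ idw [B]) = (idw [B] ⊗ Δ) ∘ φ
   /\ (idw [B] ⊗ ε) ∘ φ = ε ⊗ idw [B])
  /\ (ΔC ⊗ idw [F]) ∘ (idw [F] ⊗ φ) ∘ (Δ ⊗ idw [B])
     = (idw [B] ⊗ φ) ∘ (φ ⊗ idw [B]) ∘ (idw [F] ⊗ ΔC) ∘ (Δ ⊗ idw [B])
  /\ (εC ⊗ idw [F]) ∘ (idw [F] ⊗ φ) ∘ (Δ ⊗ idw [B])
     = (idw [F] ⊗ εC) ∘ (Δ ⊗ idw [B])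
  /\ (idw [B] ⊗ ΔC) ∘ (φ ⊗ idw [B]) ∘ (idw [F] ⊗ ΔC) ∘ (Δ ⊗ idw [B])
     = (ΔC ⊗ idw [B]) ∘ (idw [F] ⊗ ΔC) ∘ (Δ ⊗ idw [B])
  /\ ((idw [B] ⊗ εC) ∘ (φ ⊗ idw [B]) ∘ (idw [F] ⊗ ΔC) ∘ (Δ ⊗ idw [B])
        = ε ⊗ idw [B]
      /\ (εC ⊗ idw [B]) ∘ (idw [F] ⊗ ΔC) ∘ (Δ ⊗ idw [B]) = ε ⊗ idw [B]).

Record HopfCells (B F : cell1 A A) : Type := {
  onB : StructureCells B;
  onF : StructureCells F;
  τBB : cell [B; B] [B; B];
  τBF : cell [B; F] [F; B];
  τFB : cell [F; B] [B; F];
  τFF : cell [F; F] [F; F]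
}.

Record MonadHopfCells (B F : cell1 A A) : Type := {
  monad_base :> HopfCells B F;
  l : cell [B; F] [F];
  r : cell [B; F] [B];
  σ : cell [F; F] [B]
}.

Record ComonadHopfCells (B F : cell1 A A) : Type := {
  comonad_base :> HopfCells B F;
  c : cell [B] [B; F];
  d : cell [F] [B; F];
  ρ' : cell [F] [B; B]
}.

End Notions.

Notation mB D := (mul (onB D)).
Notation ηB D := (unit (onB D)).
Notation ΔB D := (comul (onB D)).
Notation εB D := (counit (onB D)).
Notation mF D := (mul (onF D)).
Notation ηF D := (unit (onF D)).
Notation ΔF D := (comul (onF D)).
Notation εF D := (counit (onF D)).

Section HopfData.
Context {K : TwoCategory} {A : K} {B F : cell1 A A}.

Definition is_prebimonad X (x : @StructureCells K A X) : Prop :=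
  counit x ∘ mul x = counit x ⊗ counit x
  /\ comul x ∘ unit x = unit x ⊗ unit x
  /\ counit x ∘ unit x = idw [].

Definition all_distributive (D : HopfCells B F) : Prop :=
  is_distributive_law (onB D) (onB D) (τBB D)
  /\ is_distributive_law (onB D) (onF D) (τBF D)
  /\ is_distributive_law (onF D) (onB D) (τFB D)
  /\ is_distributive_law (onF D) (onF D) (τFF D).

Definition ηM (D : HopfCells B F) : cell [] [F; B] := ηF D ⊗ ηB D.

Definition ψ (D : MonadHopfCells B F) : cell [B; F] [F; B] :=
  (l D ⊗ r D) ∘ (idw [B] ⊗ τBF D ⊗ idw [F]) ∘ (ΔB D ⊗ ΔF D).

Definition μM (D : MonadHopfCells B F) : cell [F; F] [F; B] :=
  (mF D ⊗ σ D) ∘ (idw [F] ⊗ τFF D ⊗ idw [F]) ∘ (ΔF D ⊗ ΔF D).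

Record is_monad_Hopf_datum (D : MonadHopfCells B F) : Prop := {
  mhd_monad : is_monad (mB D) (ηB D);
  mhd_B : is_prebimonad (onB D);
  mhd_F : is_prebimonad (onF D);
  mhd_l_module : is_left_module (mB D) (ηB D) (l D);
  mhd_εF_l : εF D ∘ l D = εB D ⊗ εF D;
  mhd_εB_r : εB D ∘ r D = εB D ⊗ εF D;
  mhd_τ : all_distributive D;
  mhd_l_mF :
    mF D ∘ (idw [F] ⊗ l D) ∘ (ψ D ⊗ idw [F]) = l D ∘ (idw [B] ⊗ mF D);
  mhd_l_ηF : l D ∘ (idw [B] ⊗ ηF D) = ηF D ∘ εB D;
  mhd_mF_assoc :
    mF D ∘ (idw [F] ⊗ mF D) = mF D ∘ (idw [F] ⊗ l D) ∘ (μM D ⊗ idw [F]);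
  mhd_mF_unitl : mF D ∘ (idw [F] ⊗ l D) ∘ (ηM D ⊗ idw [F]) = idw [F];
  mhd_mF_unitr : mF D ∘ (idw [F] ⊗ ηF D) = idw [F];
  mhd_r_mB :
    mB D ∘ (r D ⊗ idw [B]) ∘ (idw [B] ⊗ ψ D) = r D ∘ (mB D ⊗ idw [F]);
  mhd_r_ηB : r D ∘ (ηB D ⊗ idw [F]) = ηB D ∘ εF D;
  mhd_σ_ψ :
    mB D ∘ (σ D ⊗ idw [B]) ∘ (idw [F] ⊗ ψ D) ∘ (ψ D ⊗ idw [F])
    = mB D ∘ (r D ⊗ idw [B]) ∘ (idw [B] ⊗ μM D);
  mhd_r_ηM :
    mB D ∘ (εF D ⊗ idw [B; B]) ∘ (ηM D ⊗ idw [B])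
    = mB D ∘ (r D ⊗ idw [B]) ∘ (idw [B] ⊗ ηM D);
  mhd_σ_cocycle :
    mB D ∘ (σ D ⊗ idw [B]) ∘ (idw [F] ⊗ μM D)
    = mB D ∘ (σ D ⊗ idw [B]) ∘ (idw [F] ⊗ ψ D) ∘ (μM D ⊗ idw [F]);
  mhd_σ_unitl :
    mB D ∘ (σ D ⊗ idw [B]) ∘ (idw [F] ⊗ ψ D) ∘ (ηM D ⊗ idw [F])
    = ηB D ∘ εF D;
  mhd_σ_unitr :
    mB D ∘ (σ D ⊗ idw [B]) ∘ (idw [F] ⊗ ηM D) = ηB D ∘ εF D;
  mhd_εB_σ : εB D ∘ σ D = εF D ⊗ εF D
}.

Definition l_trivial (D : MonadHopfCells B F) : Prop := l D = εB D ⊗ idw [F].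
Definition r_trivial (D : MonadHopfCells B F) : Prop := r D = idw [B] ⊗ εF D.
Definition σ_trivial (D : MonadHopfCells B F) : Prop :=
  σ D = ηB D ∘ (εF D ⊗ εF D).

Definition ψ1 (D : MonadHopfCells B F) : cell [B; F] [F; B] :=
  (l D ⊗ idw [B]) ∘ (idw [B] ⊗ τBF D) ∘ (ΔB D ⊗ idw [F]).

Definition ψ2 (D : MonadHopfCells B F) : cell [B; F] [F; B] :=
  (idw [F] ⊗ r D) ∘ (τBF D ⊗ idw [F]) ∘ (idw [B] ⊗ ΔF D).

Definition εC' (D : HopfCells B F) : cell [F; B] [] := εF D ⊗ εB D.

Definition φ' (D : ComonadHopfCells B F) : cell [F; B] [B; F] :=
  (mB D ⊗ mF D) ∘ (idw [B] ⊗ τFB D ⊗ idw [F]) ∘ (d D ⊗ c D).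

Definition ΔC' (D : ComonadHopfCells B F) : cell [F; B] [B; B] :=
  (mB D ⊗ mB D) ∘ (idw [B] ⊗ τBB D ⊗ idw [B]) ∘ (ρ' D ⊗ ΔB D).

Record is_comonad_Hopf_datum (D : ComonadHopfCells B F) : Prop := {
  chd_comonad : is_comonad (ΔF D) (εF D);
  chd_B : is_prebimonad (onB D);
  chd_F : is_prebimonad (onF D);
  chd_c_comodule : is_right_comodule (ΔF D) (εF D) (c D);
  chd_c_ηB : c D ∘ ηB D = ηB D ⊗ ηF D;
  chd_d_ηF : d D ∘ ηF D = ηB D ⊗ ηF D;
  chd_τ : all_distributive D;
  chd_c_ΔB :
    (idw [B] ⊗ φ' D) ∘ (c D ⊗ idw [B]) ∘ ΔB D = (ΔB D ⊗ idw [F]) ∘ c D;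
  chd_c_εB : (εB D ⊗ idw [F]) ∘ c D = ηF D ∘ εB D;
  chd_ΔB_coassoc :
    (ΔB D ⊗ idw [B]) ∘ ΔB D = (idw [B] ⊗ ΔC' D) ∘ (c D ⊗ idw [B]) ∘ ΔB D;
  chd_ΔB_counitr : (idw [B] ⊗ εC' D) ∘ (c D ⊗ idw [B]) ∘ ΔB D = idw [B];
  chd_ΔB_counitl : (εB D ⊗ idw [B]) ∘ ΔB D = idw [B];
  chd_d_ΔF :
    (φ' D ⊗ idw [F]) ∘ (idw [F] ⊗ d D) ∘ ΔF D = (idw [B] ⊗ ΔF D) ∘ d D;
  chd_d_εF : (idw [B] ⊗ εF D) ∘ d D = ηB D ∘ εF D;
  chd_ρ_φ :
    (ΔC' D ⊗ idw [F]) ∘ (idw [F] ⊗ d D) ∘ ΔF D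
    = (idw [B] ⊗ φ' D) ∘ (φ' D ⊗ idw [B]) ∘ (idw [F] ⊗ ρ' D) ∘ ΔF D;
  chd_d_εC :
    (εC' D ⊗ idw [F]) ∘ (idw [F] ⊗ d D) ∘ ΔF D
    = (idw [F] ⊗ εC' D) ∘ (ΔF D ⊗ ηB D);
  chd_ρ_cocycle :
    (idw [B] ⊗ ΔC' D) ∘ (φ' D ⊗ idw [B]) ∘ (idw [F] ⊗ ρ' D) ∘ ΔF D
    = (ΔC' D ⊗ idw [B]) ∘ (idw [F] ⊗ ρ' D) ∘ ΔF D;
  chd_ρ_counitr :
    (idw [B] ⊗ εC' D) ∘ (φ' D ⊗ idw [B]) ∘ (idw [F] ⊗ ρ' D) ∘ ΔF D
    = ηB D ∘ εF D;
  chd_ρ_counitl :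
    (εC' D ⊗ idw [B]) ∘ (idw [F] ⊗ ρ' D) ∘ ΔF D = ηB D ∘ εF D;
  chd_ρ_ηF : ρ' D ∘ ηF D = ηB D ⊗ ηB D
}.

Definition c_trivial (D : ComonadHopfCells B F) : Prop := c D = idw [B] ⊗ ηF D.
Definition d_trivial (D : ComonadHopfCells B F) : Prop := d D = ηB D ⊗ idw [F].
Definition ρ'_trivial (D : ComonadHopfCells B F) : Prop :=
  ρ' D = (ηB D ⊗ ηB D) ∘ εF D.

Definition φ'1 (D : ComonadHopfCells B F) : cell [F; B] [B; F] :=
  (idw [B] ⊗ mF D) ∘ (τFB D ⊗ idw [F]) ∘ (idw [F] ⊗ c D).

Definition φ'2 (D : ComonadHopfCells B F) : cell [F; B] [B; F] :=
  (mB D ⊗ idw [F]) ∘ (idw [B] ⊗ τFB D) ∘ (d D ⊗ idw [B]).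

End HopfData.

(* Main.v *)
Require Import Defs.
From Stdlib Require Import List Arith Lia Eqdep.
Import ListNotations.

(* Every identity lives in a strict monoidal category and is an equality of string
   diagrams, obtained by rewriting its two sides to a common diagram.  In (1)
   the counit laws [(ε_B ⊗ B) ∘ Δ_B = B] and [(F ⊗ ε_F) ∘ Δ_F = F], which are not assumed,
   come from the compatibility of [r] with [m_B] and from [ψ = ψ1], precomposed with units;
   in (2) the two nontrivial identities reduce, after expanding all comultiplications, to the
   σ-identities of the datum and the two Yang-Baxter equations.  Reversing both the 1-cells
   and the 2-cells and exchanging [B] and [F] turns (1), (2) into (3), (4). *)

(** * Strict monoidal categories of words *)

(** The obstacle is dependent typing: in the hom-sets of [K], every use of associativity or
    interchange would drag a transport along. The identities are therefore settled by computation on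
    a first-order syntax of diagrams. Only soundness is proved about the rewriting; confluence,
    termination and completeness are never claimed, since each use ends with a comparison of two
    computed normal forms. Nothing beyond the axioms of a strict monoidal category enters, so a
    single calculation can be evaluated both in the category of a datum and in an opposite category.
    What remains to be chosen by hand is short: an orientation of the laws, and the few places where
    a law has to be used against it, mostly because an identity of the datum contains [μM] as a
    block that the expansion has torn apart. *)

Inductive color : Set := B | F.
Definition word := list color.

Definition color_eq_dec (x y : color) : {x = y} + {x <> y}.
Proof. decide equality. Defined.

Definition word_eq_dec : forall u v : word, {u = v} + {u <> v} :=
  list_eq_dec color_eq_dec.
Arguments word_eq_dec : simpl never.

(* Source and target are bundled with the arrows, so that the laws of [tensor] need no
   transport; [comp] is total, with junk values when source and target do not match. *)
Record StrictMonoidal : Type := {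
  arrow : Type;
  source : arrow -> word;
  target : arrow -> word;
  ident : word -> arrow;
  comp : arrow -> arrow -> arrow;
  tensor : arrow -> arrow -> arrow;
  source_ident : forall w, source (ident w) = w;
  target_ident : forall w, target (ident w) = w;
  source_comp : forall g f, target f = source g -> source (comp g f) = source f;
  target_comp : forall g f, target f = source g -> target (comp g f) = target g;
  source_tensor : forall f g, source (tensor f g) = source f ++ source g;
  target_tensor : forall f g, target (tensor f g) = target f ++ target g;
  compA : forall h g f, target f = source g -> target g = source h ->
    comp h (comp g f) = comp (comp h g) f;
  comp_identl : forall f, comp (ident (target f)) f = f;
  comp_identr : forall f, comp f (ident (source f)) = f;
  tensorA : forall f g h, tensor f (tensor g h) = tensor (tensor f g) h;
  tensor_nill : forall f, tensor (ident []) f = f;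
  tensor_nilr : forall f, tensor f (ident []) = f;
  tensor_ident : forall u v, tensor (ident u) (ident v) = ident (u ++ v);
  tensor_comp : forall g f g' f', target f = source g -> target f' = source g' ->
    tensor (comp g f) (comp g' f') = comp (tensor g g') (tensor f f')
}.

Arguments source {s} _.
Arguments target {s} _.
Arguments ident {s} _.
Arguments comp {s} _ _.
Arguments tensor {s} _ _.

(** Since the tensor product is exchanged as well, an object is represented by its reversed word;
    this keeps source and target compatible with concatenation. *)
Definition opposite (M : StrictMonoidal) : StrictMonoidal.
Proof.
refine {| arrow := arrow M;
  source := fun f => rev (target f);
  target := fun f => rev (source f);
  ident := fun w => ident (rev w);
  comp := fun g f => comp f g;
  tensor := fun f g => tensor g f |}.
- intros; rewrite target_ident; apply rev_involutive.
- intros; rewrite source_ident; apply rev_involutive.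
- intros g f e%(f_equal (@rev _)); rewrite !rev_involutive in e.
  now rewrite target_comp.
- intros g f e%(f_equal (@rev _)); rewrite !rev_involutive in e.
  now rewrite source_comp.
- intros; rewrite target_tensor; apply rev_app_distr.
- intros; rewrite source_tensor; apply rev_app_distr.
- intros h g f e%(f_equal (@rev _)) e'%(f_equal (@rev _)).
  rewrite !rev_involutive in e, e'; now rewrite compA.
- intros; rewrite rev_involutive; apply comp_identr.
- intros; rewrite rev_involutive; apply comp_identl.
- intros; symmetry; apply tensorA.
- intros; apply tensor_nilr.
- intros; apply tensor_nill.
- intros; rewrite tensor_ident; now rewrite rev_app_distr.
- intros g f g' f' e%(f_equal (@rev _)) e'%(f_equal (@rev _)).
  rewrite !rev_involutive in e, e'; now rewrite tensor_comp.
Defined.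

(** * The 1-cells of [A] as a strict monoidal category without transport *)

Section Bundling.
Context {K : TwoCategory} {A : K}.

Definition bundle : Type := {X : cell1 A A & {Y : cell1 A A & cell2 X Y}}.
Definition bundled {X Y : cell1 A A} (h : cell2 X Y) : bundle :=
  existT _ X (existT _ Y h).

Definition hcomp_bundle (p q : bundle) : bundle :=
  bundled (hcomp (projT2 (projT2 p)) (projT2 (projT2 q))).

(** The family [C] covers both kinds of transport in use: along equalities of 1-cells ([C] the
    identity) and along equalities of words ([C] is [composite]). A bundle sees neither. *)
Lemma bundled_transport {T : Type} (C : T -> cell1 A A) (x x' y y' : T)
    (p : x = x') (q : y = y') (h : cell2 (C x) (C y)) :
  bundled (transport2 (H := fun x y => cell2 (C x) (C y)) p q h) = bundled h.
Proof. now destruct p, q. Qed.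

Lemma bundled_tens (u u' v v' : list (cell1 A A)) (f : cell u u') (g : cell v v') :
  bundled (f ⊗ g) = hcomp_bundle (bundled f) (bundled g).
Proof. exact (bundled_transport (fun X => X) _ _ _ _ _ _ _). Qed.

Lemma hcomp_bundleA (p q s : bundle) :
  hcomp_bundle p (hcomp_bundle q s) = hcomp_bundle (hcomp_bundle p q) s.
Proof.
destruct p as [X [X' f]], q as [Y [Y' g]], s as [Z [Z' h]].
unfold hcomp_bundle; cbn; rewrite <- hcompA; symmetry.
exact (bundled_transport (fun X => X) _ _ _ _ _ _ _).
Qed.

Lemma hcomp_bundle_nill (p : bundle) : hcomp_bundle (bundled (id2 (id1 A))) p = p.
Proof.
destruct p as [X [X' f]]; unfold hcomp_bundle; cbn.
rewrite <- (hcomp_id1l f) at 2; symmetry.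
exact (bundled_transport (fun X => X) _ _ _ _ _ _ _).
Qed.

Lemma hcomp_bundle_nilr (p : bundle) : hcomp_bundle p (bundled (id2 (id1 A))) = p.
Proof.
destruct p as [X [X' f]]; unfold hcomp_bundle; cbn.
rewrite <- (hcomp_id1r f) at 2; symmetry.
exact (bundled_transport (fun X => X) _ _ _ _ _ _ _).
Qed.

(** Equality of 1-cells need not be decidable, so this rests on uniqueness of identity proofs as an
    axiom. *)
Lemma bundled_inj (X Y : cell1 A A) (f g : cell2 X Y) : bundled f = bundled g -> f = g.
Proof. intros e; apply inj_pair2 in e; now apply inj_pair2 in e. Qed.

Lemma transport2_id2 (X X' : cell1 A A) (p : X = X') :
  transport2 p p (id2 X) = id2 X'.
Proof. now destruct p. Qed.

Lemma transport2_vcomp (X Y Z X' Y' Z' : cell1 A A) (p : X = X') (q : Y = Y')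
    (s : Z = Z') (g : cell2 Y Z) (f : cell2 X Y) :
  transport2 p s (vcomp g f) = vcomp (transport2 q s g) (transport2 p q f).
Proof. now destruct p, q, s. Qed.

Lemma tens_idw (u v : list (cell1 A A)) : idw u ⊗ idw v = idw (u ++ v).
Proof. unfold tens, idw; rewrite hcomp_id2; apply transport2_id2. Qed.

Lemma tens_vert (u v w u' v' w' : list (cell1 A A))
    (g : cell v w) (f : cell u v) (g' : cell v' w') (f' : cell u' v') :
  (g ∘ f) ⊗ (g' ∘ f') = (g ⊗ g') ∘ (f ⊗ f').
Proof. unfold tens, vert; rewrite hcomp_vcomp; apply transport2_vcomp. Qed.

Lemma transport2_idw (u u' : list (cell1 A A)) (p : u = u') :
  transport2 p p (idw u) = idw u'.
Proof. now destruct p. Qed.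

Lemma transport2_vert (u v w u' v' w' : list (cell1 A A)) (p : u = u') (q : v = v')
    (s : w = w') (g : cell v w) (f : cell u v) :
  transport2 p s (g ∘ f) = transport2 q s g ∘ transport2 p q f.
Proof. now destruct p, q, s. Qed.

Section Letters.
Context (letter : color -> cell1 A A).

Definition letters (w : word) : list (cell1 A A) := map letter w.
Definition hom (u v : word) : Type := cell (letters u) (letters v).
(** The words are stored because the 1-cells do not determine them: the two letters may be equal,
    and distinct words may have equal composites. *)
Record arr : Type := toarr { arr_source : word; arr_target : word;
  arr_cell : hom arr_source arr_target }.
Arguments toarr {arr_source arr_target} _.

Lemma toarr_inj (u v : word) (f g : hom u v) : toarr f = toarr g -> f = g.
Proof. intros [= e]; apply inj_pair2 in e; now apply inj_pair2 in e. Qed.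

Lemma arr_eq (p q : arr) : arr_source p = arr_source q ->
  arr_target p = arr_target q -> bundled (arr_cell p) = bundled (arr_cell q) -> p = q.
Proof.
destruct p as [u v f], q as [u' v' f']; cbn; intros <- <- e.
f_equal; now apply bundled_inj.
Qed.

(** A transparent recursion, so that on concrete words it computes to [eq_refl] and [tensor_hom] is
    convertible to [tens]. Reification depends on this. *)
Fixpoint letters_app (u v : word) : letters u ++ letters v = letters (u ++ v) :=
  match u with
  | [] => eq_refl
  | x :: u => f_equal (cons (letter x)) (letters_app u v)
  end.

Definition tensor_hom {u u' v v' : word} (f : hom u u') (g : hom v v') :
    hom (u ++ v) (u' ++ v') :=
  transport2 (H := fun x y => @cell K A x y)
    (letters_app u v) (letters_app u' v') (f ⊗ g).

Definition comp_arr (g f : arr) : arr :=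
  match word_eq_dec (arr_target f) (arr_source g) with
  | left e =>
    toarr (arr_cell g ∘ eq_rect _ (hom (arr_source f)) (arr_cell f) _ e)
  | right _ => f
  end.

Definition tensor_arr (f g : arr) : arr :=
  toarr (tensor_hom (arr_cell f) (arr_cell g)).

Lemma comp_toarr (u v w : word) (g : hom v w) (f : hom u v) :
  comp_arr (toarr g) (toarr f) = @toarr u w (g ∘ f).
Proof.
unfold comp_arr; cbn [arr_source arr_target arr_cell].
destruct (word_eq_dec v v) as [e|ne]; [|now destruct ne].
now rewrite (Eqdep_dec.UIP_dec word_eq_dec e eq_refl).
Qed.

Lemma bundled_tensor (f g : arr) :
  bundled (arr_cell (tensor_arr f g))
  = hcomp_bundle (bundled (arr_cell f)) (bundled (arr_cell g)).
Proof.
cbn; unfold tensor_hom; rewrite <- bundled_tens.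
exact (bundled_transport composite _ _ _ _ _ _ _).
Qed.

Lemma tensor_hom_vert (u v w u' v' w' : word)
    (g : hom v w) (f : hom u v) (g' : hom v' w') (f' : hom u' v') :
  tensor_hom (u := u) (u' := w) (v := u') (v' := w') (g ∘ f) (g' ∘ f')
  = tensor_hom g g' ∘ tensor_hom f f'.
Proof.
unfold tensor_hom; rewrite tens_vert; apply transport2_vert.
Qed.

Definition words_monoidal : StrictMonoidal.
Proof.
refine {| arrow := arr;
  source := arr_source;
  target := arr_target;
  ident := fun w => @toarr w w (idw (letters w));
  comp := comp_arr;
  tensor := tensor_arr |}.
- reflexivity.
- reflexivity.
- intros g f _; unfold comp_arr; now destruct word_eq_dec.
- intros g f e; unfold comp_arr; now destruct word_eq_dec.
- reflexivity.
- reflexivity.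
- intros [w' z h] [v' w g] [u v f] e e'; cbn in e, e'; subst.
  rewrite !comp_toarr; apply (f_equal (@toarr u z)), vcompA.
- intros [u v f]; cbn [arr_target].
  rewrite comp_toarr; apply (f_equal (@toarr u v)), vcomp_id2l.
- intros [u v f]; cbn [arr_source].
  rewrite comp_toarr; apply (f_equal (@toarr u v)), vcomp_id2r.
- intros f g h; apply arr_eq; [apply app_assoc..|].
  rewrite !bundled_tensor; apply hcomp_bundleA.
- intros f; apply arr_eq; [reflexivity..|].
  rewrite bundled_tensor; apply hcomp_bundle_nill.
- intros f; apply arr_eq; [apply app_nil_r..|].
  rewrite bundled_tensor; apply hcomp_bundle_nilr.
- intros u v; apply (f_equal (@toarr (u ++ v) (u ++ v))); cbn.
  unfold tensor_hom; rewrite tens_idw; apply transport2_idw.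
- intros [v' w g] [u v f] [v1' w1 g'] [u1 v1 f'] e e'; cbn in e, e'; subst.
  rewrite !comp_toarr; unfold tensor_arr; cbn [arr_source arr_target arr_cell].
  rewrite comp_toarr; apply (f_equal (@toarr (u ++ u1) (w ++ w1))), tensor_hom_vert.
Defined.
End Letters.
End Bundling.

(** * String diagrams *)

Inductive generator : Set :=
  | m (x : color) | η (x : color) | Δ (x : color) | ε (x : color)
  | τ (x y : color) | lact | ract | cocycle.

Definition dom_generator (g : generator) : word :=
  match g with
  | m x => [x; x] | η x => [] | Δ x => [x] | ε x => [x]
  | τ x y => [x; y] | lact | ract => [B; F] | cocycle => [F; F]
  end.

Definition cod_generator (g : generator) : word :=
  match g with
  | m x => [x] | η x => [x] | Δ x => [x; x] | ε x => []
  | τ x y => [y; x] | lact => [F] | ract | cocycle => [B]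
  end.

Inductive term : Set :=
  | Gen (g : generator)
  | Id (w : word)
  | Comp (s t : term)
  | Tensor (s t : term).

Fixpoint dom (t : term) : word :=
  match t with
  | Gen g => dom_generator g
  | Id w => w
  | Comp _ t => dom t
  | Tensor s t => dom s ++ dom t
  end.

Fixpoint cod (t : term) : word :=
  match t with
  | Gen g => cod_generator g
  | Id w => w
  | Comp s _ => cod s
  | Tensor s t => cod s ++ cod t
  end.

Definition word_eqb (u v : word) : bool := if word_eq_dec u v then true else false.

Fixpoint well_typed (t : term) : bool :=
  match t with
  | Gen _ | Id _ => true
  | Comp s t => well_typed s && well_typed t && word_eqb (cod t) (dom s)
  | Tensor s t => well_typed s && well_typed t
  end.

(* [(x, g, y)] is the 2-cell [x ⊗ g ⊗ y]; a diagram lists its layers from top to bottom. *)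
Definition layer : Set := (word * generator * word)%type.
Definition diagram : Set := list layer.

Definition layer_eq_dec (L M : layer) : {L = M} + {L <> M}.
Proof. repeat decide equality. Defined.

Definition diagram_eq_dec : forall d e : diagram, {d = e} + {d <> e} :=
  list_eq_dec layer_eq_dec.

Fixpoint run (u : word) (d : diagram) : option word :=
  match d with
  | [] => Some u
  | (x, g, y) :: d =>
    if word_eq_dec u (x ++ dom_generator g ++ y)
    then run (x ++ cod_generator g ++ y) d else None
  end.

Definition pad (x : word) (d : diagram) (y : word) : diagram :=
  map (fun '(x', g, y') => (x ++ x', g, y' ++ y)) d.

Fixpoint flatten (t : term) : diagram :=
  match t with
  | Gen g => [([], g, [])]
  | Id _ => []
  | Comp s t => flatten t ++ flatten s
  | Tensor s t => pad [] (flatten s) (dom t) ++ pad (cod s) (flatten t) []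
  end.

(** [M] comes after [L]. If its generator lies entirely to the left of that of [L], it can come
    before; [z] is the block of wires between the two. *)
Definition exchange_left (L M : layer) : option (layer * layer) :=
  let '(x, g, y) := L in
  let '(x', h, y') := M in
  let n := length x' + length (dom_generator h) in
  if n <=? length x then
    let z := skipn n x in
    Some ((x', h, z ++ dom_generator g ++ y), (x' ++ cod_generator h ++ z, g, y))
  else None.

Definition exchange_right (L M : layer) : option (layer * layer) :=
  let '(x, g, y) := L in
  let '(x', h, y') := M in
  let n := length x + length (cod_generator g) in
  if n <=? length x' then
    let z := skipn n x' in
    Some ((x ++ dom_generator g ++ z, h, y'), (x, g, z ++ cod_generator h ++ y'))
  else None.

Fixpoint exchange_pass (d : diagram) : diagram :=
  match d with
  | [] => []
  | L :: d =>
    match exchange_pass d with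
    | [] => [L]
    | M :: d' =>
      match exchange_left L M with
      | Some (M', L') => M' :: L' :: d'
      | None => L :: M :: d'
      end
    end
  end.

(* A normal form for the interchange law (complete in the connected case, which is
   all that matters here; soundness is unconditional). *)
Definition normal_form (d : diagram) : diagram :=
  Nat.iter (2 * length d) exchange_pass d.

(* The search for an occurrence of a diagram in another one, up to interchange, is not
   proved correct: [rewrite_with] checks its result. *)
Fixpoint pull_up (d : diagram) (M : layer) : option (layer * diagram) :=
  match d with
  | [] => Some (M, [])
  | L :: d =>
    match pull_up d M with
    | Some (M', d') =>
      match exchange_left L M', exchange_right L M' with
      | Some (M'', L'), _ | None, Some (M'', L') => Some (M'', L' :: d')
      | None, None => None
      end
    | None => None
    end
  end.

Fixpoint find_layer (L : layer) (above below : diagram) : option diagram :=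
  match below with
  | [] => None
  | M :: below =>
    match pull_up above M with
    | Some (M', above') =>
      if layer_eq_dec M' L then Some (above' ++ below)
      else find_layer L (above ++ [M]) below
    | None => find_layer L (above ++ [M]) below
    end
  end.

(** A pattern may take an input from a generator that stands below the part already matched. Such a
    generator has to be moved above the block before the next layer of the pattern can appear in its
    place. *)
Fixpoint raise_layer (block above below : diagram) :
    option (layer * diagram * diagram) :=
  match below with
  | [] => None
  | M :: below =>
    match pull_up above M with
    | Some (M', above') =>
      match pull_up block M' with
      | Some (M'', block') => Some (M'', block', above' ++ below)
      | None => raise_layer block (above ++ [M]) below
      end
    | None => raise_layer block (above ++ [M]) below
    end
  end.

Definition context_of (L L0 : layer) : option (word * word) :=
  let '(x, g, y) := L in
  let '(x0, g0, y0) := L0 in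
  let x' := firstn (length x - length x0) x in
  let y' := skipn (length y0) y in
  if layer_eq_dec L (x' ++ x0, g0, y0 ++ y') then Some (x', y') else None.

Definition next_layer (context : option (word * word)) (lhs after : diagram) :
    option (layer * diagram * diagram) :=
  match context, lhs with
  | Some (x, y), (x', g, y') :: lhs =>
    let M := (x ++ x', g, y' ++ y) in
    option_map (fun after' => (M, lhs, after')) (find_layer M [] after)
  | _, _ => None
  end.

(** A greedy search without backtracking. The context is recomputed from the first layer of [block]
    each time, because raising a layer changes the wires on both sides. Lack of fuel can only miss
    an occurrence. *)
Fixpoint complete_occurrence (fuel : nat) (L0 : layer) (before block : diagram)
    (lhs after : diagram) : option (diagram * word * word * diagram) :=
  match fuel, block with
  | S fuel, L :: _ =>
    match context_of L L0, lhs with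
    | Some (x, y), [] => Some (before, x, y, after)
    | context, _ =>
      match next_layer context lhs after with
      | Some (M, lhs', after') =>
        complete_occurrence fuel L0 before (block ++ [M]) lhs' after'
      | None =>
        match raise_layer block [] after with
        | Some (M, block', after') =>
          complete_occurrence fuel L0 (before ++ [M]) block' lhs after'
        | None => None
        end
      end
    end
  | _, _ => None
  end.

Fixpoint find_occurrence (lhs before after : diagram) :
    option (diagram * word * word * diagram) :=
  match lhs, after with
  | L0 :: lhs', L :: after' =>
    match complete_occurrence 100 L0 before [L] lhs' after' with
    | Some occ => Some occ
    | None => find_occurrence lhs (before ++ [L]) after'
    end
  | _, _ => None
  end.

Definition law : Set := (term * term)%type.
Definition flip (r : law) : law := (snd r, fst r).

Definition law_eq_dec (p q : law) : {p = q} + {p <> q}.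
Proof. repeat decide equality. Defined.

Definition well_formed (r : law) : bool :=
  well_typed (fst r) && well_typed (snd r)
  && word_eqb (dom (fst r)) (dom (snd r)) && word_eqb (cod (fst r)) (cod (snd r)).

Definition option_word_eq_dec (u v : option word) : {u = v} + {u <> v}.
Proof. decide equality; apply word_eq_dec. Defined.

Definition rewrite_with (r : law) (u : word) (d : diagram) : option diagram :=
  let (s, t) := r in
  match find_occurrence (flatten s) [] (normal_form d) with
  | Some (d1, x, y, d2) =>
    let d' := d1 ++ pad x (flatten s) y ++ d2 in
    if well_formed r then
    if diagram_eq_dec (normal_form d') (normal_form d) then
    if option_word_eq_dec (run u d') (run u d) then
    if option_word_eq_dec (run u d1) (Some (x ++ dom s ++ y)) then
      Some (d1 ++ pad x (flatten t) y ++ d2)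
    else None else None else None else None
  | None => None
  end.

Fixpoint rewrite_any (rs : list law) (u : word) (d : diagram) : option diagram :=
  match rs with
  | [] => None
  | r :: rs =>
    match rewrite_with r u d with
    | Some e => Some e
    | None => rewrite_any rs u d
    end
  end.

Fixpoint rewrite_upto (n : nat) (rs : list law) (u : word) (d : diagram) : diagram :=
  match n with
  | 0 => d
  | S n =>
    match rewrite_any rs u d with
    | Some e => rewrite_upto n rs u e
    | None => d
    end
  end.

(* A step [(n, rs)] applies the laws [rs], read from left to right, at most [n] times. *)
Definition step : Set := (nat * list law)%type.

Definition rewrite_steps (ps : list step) (u : word) (d : diagram) : diagram :=
  fold_left (fun d p => rewrite_upto (fst p) (snd p) u d) ps d.

Definition laws_of (ps : list step) : list law := concat (map snd ps).

Definition covered (T : list law) (ps : list step) : bool :=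
  forallb (fun r => if in_dec law_eq_dec r T then true
                    else if in_dec law_eq_dec (flip r) T then true else false)
    (laws_of ps).

Definition joins (T : list law) (ps qs : list step) (s t : term) : bool :=
  covered T ps && covered T qs && well_formed (s, t)
  && if diagram_eq_dec (normal_form (rewrite_steps ps (dom s) (flatten s)))
       (normal_form (rewrite_steps qs (dom t) (flatten t))) then true else false.

(** An overlap argument, as with critical pairs: the diagram [t0] is rewritten in two ways, and the
    two results are the sides of a new law. *)
Definition peaks (T : list law) (t0 : term) (ps qs : list step) (s t : term) : bool :=
  joins T ps [] t0 s && joins T qs [] t0 t.

Record Model : Type := {
  carrier : StrictMonoidal;
  value_generator : generator -> arrow carrier;
  source_generator : forall g, source (value_generator g) = dom_generator g;
  target_generator : forall g, target (value_generator g) = cod_generator g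
}.

Lemma app_eq_skipn (a p c q : word) : a ++ p = c ++ q -> length c <= length a ->
  a = c ++ skipn (length c) a /\ q = skipn (length c) a ++ p.
Proof.
revert a; induction c as [|x c IH]; cbn; intros a e le; [easy|].
destruct a as [|y a]; cbn in *; [lia|].
injection e as -> e; destruct (IH a e) as [e1 e2]; [lia|].
split; [now f_equal|easy].
Qed.

Lemma word_eqb_eq (u v : word) : word_eqb u v = true -> u = v.
Proof. unfold word_eqb; now destruct word_eq_dec. Qed.

(** * Values of diagrams and soundness of rewriting *)

Section Soundness.
Context (M : Model).
Notation C := (carrier M).

Fixpoint value (t : term) : arrow C :=
  match t with
  | Gen g => value_generator M g
  | Id w => ident w
  | Comp s t => comp (value s) (value t)
  | Tensor s t => tensor (value s) (value t)
  end.

Definition holds (r : law) : Prop := value (fst r) = value (snd r).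

Definition whisker (x : word) (f : arrow C) (y : word) : arrow C :=
  tensor (ident x) (tensor f (ident y)).

Fixpoint eval (u : word) (d : diagram) : arrow C :=
  match d with
  | [] => ident u
  | (x, g, y) :: d =>
    comp (eval (x ++ cod_generator g ++ y) d) (whisker x (value_generator M g) y)
  end.

Lemma source_whisker (x : word) (f : arrow C) (y : word) :
  source (whisker x f y) = x ++ source f ++ y.
Proof. unfold whisker; now rewrite !source_tensor, !source_ident. Qed.

Lemma target_whisker (x : word) (f : arrow C) (y : word) :
  target (whisker x f y) = x ++ target f ++ y.
Proof. unfold whisker; now rewrite !target_tensor, !target_ident. Qed.

Lemma comp_ident (u : word) : comp (ident u) (ident u) = ident u :> arrow C.
Proof. rewrite <- (target_ident C u) at 1; apply comp_identl. Qed.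

Lemma comp_identl' (u : word) (f : arrow C) : target f = u -> comp (ident u) f = f.
Proof. intros <-; apply comp_identl. Qed.

Lemma comp_identr' (u : word) (f : arrow C) : source f = u -> comp f (ident u) = f.
Proof. intros <-; apply comp_identr. Qed.

Lemma whisker_comp (x : word) (g f : arrow C) (y : word) : target f = source g ->
  whisker x (comp g f) y = comp (whisker x g y) (whisker x f y).
Proof.
intros e; unfold whisker.
rewrite <- tensor_comp, comp_ident, <- tensor_comp, comp_ident; try easy.
- now rewrite target_ident, source_ident.
- now rewrite target_ident, source_ident.
- now rewrite target_tensor, source_tensor, target_ident, source_ident, e.
Qed.

Lemma whisker_ident (x u y : word) : whisker x (ident u) y = ident (x ++ u ++ y).
Proof. unfold whisker; now rewrite !tensor_ident. Qed.

Lemma whisker_whisker (x x' : word) (f : arrow C) (y y' : word) :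
  whisker x (whisker x' f y) y' = whisker (x ++ x') f (y ++ y').
Proof. unfold whisker; now rewrite <- !tensor_ident, !tensorA. Qed.

Lemma interchange_left (f g : arrow C) :
  comp (tensor (ident (target f)) g) (tensor f (ident (source g))) = tensor f g.
Proof.
rewrite <- tensor_comp, comp_identl, comp_identr; try easy.
- now rewrite source_ident.
- now rewrite target_ident.
Qed.

Lemma interchange_right (f g : arrow C) :
  comp (tensor f (ident (target g))) (tensor (ident (source f)) g) = tensor f g.
Proof.
rewrite <- tensor_comp, comp_identl, comp_identr; try easy.
- now rewrite target_ident.
- now rewrite source_ident.
Qed.

Lemma eval_source_target (d : diagram) (u v : word) : run u d = Some v ->
  source (eval u d) = u /\ target (eval u d) = v.
Proof.
revert u; induction d as [|[[x g] y] d IH]; cbn; intros u.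
- intros [= <-]; now rewrite source_ident, target_ident.
- destruct word_eq_dec as [->|]; [|easy]; intros [es et]%IH.
  rewrite source_comp, target_comp; rewrite ?target_whisker, ?source_whisker,
    ?target_generator, ?source_generator; easy.
Qed.

Lemma run_app (d e : diagram) (u : word) :
  run u (d ++ e) = match run u d with Some v => run v e | None => None end.
Proof.
revert u; induction d as [|[[x g] y] d IH]; cbn; intros u; [easy|].
now destruct word_eq_dec.
Qed.

Lemma eval_app (d e : diagram) (u v w : word) :
  run u d = Some v -> run v e = Some w ->
  eval u (d ++ e) = comp (eval v e) (eval u d).
Proof.
intros rd re; revert u rd; induction d as [|[[x g] y] d IH]; cbn; intros u.
- intros [= <-]; symmetry; apply comp_identr'.
  apply (eval_source_target _ _ _ re).
- destruct word_eq_dec as [->|]; [|easy]; intros rd; rewrite (IH _ rd).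
  symmetry; apply compA.
  + now rewrite target_whisker, target_generator, (proj1 (eval_source_target _ _ _ rd)).
  + now rewrite (proj2 (eval_source_target _ _ _ rd)),
      (proj1 (eval_source_target _ _ _ re)).
Qed.

Lemma eval_pad (d : diagram) (u v x y : word) : run u d = Some v ->
  run (x ++ u ++ y) (pad x d y) = Some (x ++ v ++ y)
  /\ eval (x ++ u ++ y) (pad x d y) = whisker x (eval u d) y.
Proof.
revert u; induction d as [|[[x' g] y'] d IH]; cbn; intros u.
- intros [= <-]; now rewrite whisker_ident.
- destruct (word_eq_dec u) as [->|]; [|easy]; intros rd.
  destruct (IH _ rd) as [r' e'].
  destruct word_eq_dec as [_|ne]; [|destruct ne; now rewrite <- !app_assoc].
  replace ((x ++ x') ++ cod_generator g ++ y' ++ y)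
    with (x ++ (x' ++ cod_generator g ++ y') ++ y) by now rewrite <- !app_assoc.
  fold (pad x d y); rewrite r', e'; split; [easy|].
  rewrite whisker_comp, whisker_whisker; [easy|].
  now rewrite target_whisker, target_generator, (proj1 (eval_source_target _ _ _ rd)).
Qed.

Lemma value_flatten (t : term) : well_typed t = true ->
  run (dom t) (flatten t) = Some (cod t) /\ eval (dom t) (flatten t) = value t.
Proof.
induction t as [g|w|s IHs t IHt|s IHs t IHt]; cbn; intros wt.
- destruct word_eq_dec as [_|ne]; [|destruct ne; now rewrite app_nil_r].
  rewrite app_nil_r; split; [easy|].
  unfold whisker; rewrite tensor_nill, tensor_nilr.
  apply comp_identl', target_generator.
- easy.
- apply andb_prop in wt as [[wts wtt]%andb_prop e%word_eqb_eq].
  destruct (IHs wts) as [rs es], (IHt wtt) as [rt et].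
  rewrite run_app, rt, e, rs. split; [easy|].
  rewrite <- e in rs, es.
  now rewrite (eval_app _ _ _ _ _ rt rs), es, et.
- apply andb_prop in wt as [wts wtt].
  destruct (IHs wts) as [rs es], (IHt wtt) as [rt et].
  destruct (eval_pad _ _ _ [] (dom t) rs) as [rs' es'].
  destruct (eval_pad _ _ _ (cod s) [] rt) as [rt' et'].
  cbn [app] in rs', es'; rewrite !app_nil_r in rt', et'.
  rewrite run_app, rs', rt', app_nil_r; split; [easy|].
  rewrite (eval_app _ _ _ _ _ rs' rt'), es', et', es, et.
  (* [flatten] runs the left factor of a tensor product first, which is this form of interchange. *)
  unfold whisker; rewrite tensor_nill, tensor_nilr, <- (interchange_left (value s) (value t)).
  destruct (eval_source_target _ _ _ rs) as [_ ts]; rewrite es in ts.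
  destruct (eval_source_target _ _ _ rt) as [st _]; rewrite et in st.
  now rewrite ts, st.
Qed.

(** Typing passes from [d] to [e] only: [exchange_left] compares lengths of words and promises
    nothing about ill-typed diagrams. *)
Definition reduces (d e : diagram) : Prop := forall u v, run u d = Some v ->
  run u e = Some v /\ eval u e = eval u d.

Lemma reduces_trans (d e h : diagram) : reduces d e -> reduces e h -> reduces d h.
Proof.
intros de eh u v rd; destruct (de u v rd) as [re <-].
exact (eh u v re).
Qed.

Lemma reduces_cons (L : layer) (d e : diagram) :
  reduces d e -> reduces (L :: d) (L :: e).
Proof.
destruct L as [[x g] y]; intros de u v; cbn.
destruct word_eq_dec as [->|]; [|easy]; intros rd.
now destruct (de _ _ rd) as [-> ->].
Qed.

Lemma reduces_exchange_left (L N L' N' : layer) (d : diagram) :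
  exchange_left L N = Some (N', L') -> reduces (L :: N :: d) (N' :: L' :: d).
Proof.
destruct L as [[x g] y], N as [[x' h] y']; cbn [exchange_left].
destruct Nat.leb eqn:le; [|easy]; intros [= <- <-] u v; cbn.
destruct (word_eq_dec u) as [->|]; [|easy].
destruct word_eq_dec as [e|]; [|easy]; intros rd.
apply Nat.leb_le in le; rewrite <- length_app in *.
rewrite (app_assoc x') in e.
destruct (app_eq_skipn _ _ _ _ e le) as [ex ey].
set (z := skipn _ _) in *; clearbody z; subst x y'.
destruct word_eq_dec as [_|ne]; [|destruct ne; now rewrite <- !app_assoc].
destruct word_eq_dec as [_|ne]; [|destruct ne; now rewrite <- !app_assoc].
rewrite <- !app_assoc; split; [easy|].
destruct (eval_source_target _ _ _ rd) as [sd _].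
set (G := value_generator M g); set (H := value_generator M h).
assert (eG : target G = cod_generator g) by apply target_generator.
assert (eG' : source G = dom_generator g) by apply source_generator.
assert (eH : target H = cod_generator h) by apply target_generator.
assert (eH' : source H = dom_generator h) by apply source_generator.
rewrite <- !compA; rewrite ?target_whisker, ?source_whisker, ?eG, ?eG', ?eH, ?eH',
  ?sd, <- ?app_assoc; try easy.
f_equal.
(* Both orders of the two layers equal the diagram in which [H] and [G] act side by side. *)
transitivity (whisker x' (tensor H (tensor (ident z) G)) y).
- rewrite <- interchange_left, whisker_comp.
  + rewrite source_tensor, source_ident, eG', eH; unfold whisker.
    now rewrite <- !tensor_ident, !tensorA.
  + now rewrite !target_tensor, !source_tensor, !target_ident, !source_ident.
- rewrite <- interchange_right, whisker_comp.
  + rewrite target_tensor, target_ident, eG, eH'; unfold whisker.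
    now rewrite <- !tensor_ident, !tensorA.
  + now rewrite !target_tensor, !source_tensor, !target_ident, !source_ident.
Qed.

Lemma reduces_exchange_pass (d : diagram) : reduces d (exchange_pass d).
Proof.
induction d as [|L d IH]; cbn; [easy|].
apply reduces_cons with (L := L) in IH; destruct (exchange_pass d) as [|N e]; [easy|].
apply (reduces_trans _ _ _ IH).
destruct exchange_left as [[N' L']|] eqn:ex; [|easy].
now apply reduces_exchange_left.
Qed.

Lemma reduces_normal_form (d : diagram) : reduces d (normal_form d).
Proof.
unfold normal_form; induction (2 * length d) as [|n IH]; cbn; [easy|].
exact (reduces_trans _ _ _ IH (reduces_exchange_pass _)).
Qed.

Lemma well_formed_inv (r : law) : well_formed r = true ->
  well_typed (fst r) = true /\ well_typed (snd r) = true
  /\ dom (fst r) = dom (snd r) /\ cod (fst r) = cod (snd r).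
Proof.
unfold well_formed; intros [[[ws wt]%andb_prop e]%andb_prop e']%andb_prop.
now apply word_eqb_eq in e, e'.
Qed.

(** The reassembled diagram is well typed and shares its normal form with [d], hence also its value;
    in it the left side of the law is a literal padded block, which can be exchanged for the right
    side. How the block was found is irrelevant. *)
Lemma rewrite_with_sound (r : law) (u v : word) (d e : diagram) :
  holds r -> run u d = Some v -> rewrite_with r u d = Some e ->
  run u e = Some v /\ eval u e = eval u d.
Proof.
destruct r as [s t]; unfold holds, rewrite_with; cbn [fst snd]; intros st rd.
destruct find_occurrence as [[[[d1 x] y] d2]|]; [|easy].
destruct well_formed eqn:wf; [|easy].
apply well_formed_inv in wf as (ws & wt & ed & ec); cbn [fst snd] in *.
destruct diagram_eq_dec as [en|]; [|easy].
destruct option_word_eq_dec as [er|]; [|easy].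
destruct option_word_eq_dec as [e1|]; [|easy]; intros [= <-].
rewrite rd in er.
destruct (value_flatten _ ws) as [rs es], (value_flatten _ wt) as [rt et].
destruct (eval_pad _ _ _ x y rs) as [rs' es'], (eval_pad _ _ _ x y rt) as [rt' et'].
rewrite <- ed, <- ec in *.
assert (r2 : run (x ++ cod s ++ y) d2 = Some v).
{ now rewrite run_app, e1, run_app, rs' in er. }
assert (rs2 : run (x ++ dom s ++ y) (pad x (flatten s) y ++ d2) = Some v).
{ now rewrite run_app, rs'. }
assert (rt2 : run (x ++ dom s ++ y) (pad x (flatten t) y ++ d2) = Some v).
{ now rewrite run_app, rt'. }
split; [now rewrite run_app, e1|].
destruct (reduces_normal_form _ _ _ rd) as [_ <-]; rewrite <- en.
destruct (reduces_normal_form _ _ _ er) as [_ ->].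
rewrite (eval_app _ _ _ _ _ e1 rs2), (eval_app _ _ _ _ _ e1 rt2),
  (eval_app _ _ _ _ _ rs' r2), (eval_app _ _ _ _ _ rt' r2).
now rewrite es', et', es, et, st.
Qed.

Lemma rewrite_any_sound (rs : list law) (u v : word) (d e : diagram) :
  Forall holds rs -> run u d = Some v -> rewrite_any rs u d = Some e ->
  run u e = Some v /\ eval u e = eval u d.
Proof.
intros hs rd; induction hs as [|r rs h _ IH]; cbn; [easy|].
destruct rewrite_with eqn:ew; [intros [= <-]|easy].
exact (rewrite_with_sound _ _ _ _ _ h rd ew).
Qed.

Lemma rewrite_upto_sound (n : nat) (rs : list law) (u v : word) (d : diagram) :
  Forall holds rs -> run u d = Some v ->
  run u (rewrite_upto n rs u d) = Some v /\ eval u (rewrite_upto n rs u d) = eval u d.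
Proof.
intros hs; revert d; induction n as [|n IH]; cbn; intros d rd; [easy|].
destruct rewrite_any eqn:ew; [|easy].
destruct (rewrite_any_sound _ _ _ _ _ hs rd ew) as [re <-]; now apply IH.
Qed.

Lemma rewrite_steps_sound (ps : list step) (u v : word) (d : diagram) :
  Forall holds (laws_of ps) -> run u d = Some v ->
  run u (rewrite_steps ps u d) = Some v /\ eval u (rewrite_steps ps u d) = eval u d.
Proof.
unfold rewrite_steps, laws_of; revert d.
induction ps as [|[n rs] ps IH]; cbn; intros d; [easy|].
intros [h hs]%Forall_app rd.
destruct (rewrite_upto_sound n _ _ _ _ h rd) as [re <-]; now apply IH.
Qed.

Lemma holds_covered (T : list law) (ps : list step) :
  Forall holds T -> covered T ps = true -> Forall holds (laws_of ps).
Proof.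
rewrite Forall_forall; intros hT; unfold covered; rewrite forallb_forall; intros cov.
apply Forall_forall; intros r hr; specialize (cov r hr).
destruct in_dec as [i|_]; [exact (hT r i)|].
destruct in_dec as [i|_]; [exact (eq_sym (hT _ i))|easy].
Qed.

Lemma holds_of_join (T : list law) (ps qs : list step) (s t : term) :
  Forall holds T -> joins T ps qs s t = true -> holds (s, t).
Proof.
intros hT; unfold joins; intros [[[cp cq]%andb_prop wf]%andb_prop e]%andb_prop.
pose proof (holds_covered _ _ hT cp) as hp; pose proof (holds_covered _ _ hT cq) as hq.
apply well_formed_inv in wf as (ws & wt & ed & _); cbn [fst snd] in *.
destruct diagram_eq_dec as [en|]; [|easy].
destruct (value_flatten _ ws) as [rs es], (value_flatten _ wt) as [rt et].
destruct (rewrite_steps_sound _ _ _ _ hp rs) as [rs' es'].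
destruct (rewrite_steps_sound _ _ _ _ hq rt) as [rt' et'].
unfold holds; cbn [fst snd]; rewrite <- es, <- et, <- es', <- et'.
destruct (reduces_normal_form _ _ _ rs') as [_ <-].
destruct (reduces_normal_form _ _ _ rt') as [_ <-].
now rewrite en, ed.
Qed.

Lemma holds_of_peak (T : list law) (t0 : term) (ps qs : list step) (s t : term) :
  Forall holds T -> peaks T t0 ps qs s t = true -> holds (s, t).
Proof.
intros hT [js jt]%andb_prop.
exact (eq_trans (eq_sym (holds_of_join _ _ _ _ _ hT js)) (holds_of_join _ _ _ _ _ hT jt)).
Qed.

(** With no laws at all, only the strict monoidal axioms remain. This bridges the bracketings and
    identities by which a law differs from the equation as written for 2-cells. *)
Lemma coherence (s t : term) : joins [] [] [] s t = true -> value s = value t.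
Proof. now apply holds_of_join. Qed.

End Soundness.

(** * The wreath identities *)

Declare Scope term_scope.
Delimit Scope term_scope with term.
Bind Scope term_scope with term.
Notation "s ∘ t" := (Comp s t) : term_scope.
Notation "s ⊗ t" := (Tensor s t) : term_scope.
Notation "s ≡ t" := (@pair term term s%term t%term) (at level 70).
Definition wire (x : color) : term := Id [x].
Coercion wire : color >-> term.
Coercion Gen : generator >-> term.

Section Laws.
Local Open Scope term_scope.
Implicit Types (x y : color) (p : term).

Definition assoc x : law := m x ∘ (m x ⊗ x) ≡ m x ∘ (x ⊗ m x).
Definition unit_l x : law := m x ∘ (η x ⊗ x) ≡ x.
Definition unit_r x : law := m x ∘ (x ⊗ η x) ≡ x.
Definition coassoc x : law := (Δ x ⊗ x) ∘ Δ x ≡ (x ⊗ Δ x) ∘ Δ x.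
Definition counit_l x : law := (ε x ⊗ x) ∘ Δ x ≡ x.
Definition counit_r x : law := (x ⊗ ε x) ∘ Δ x ≡ x.
Definition comul_mul x : law :=
  Δ x ∘ m x ≡ (m x ⊗ m x) ∘ (x ⊗ τ x x ⊗ x) ∘ (Δ x ⊗ Δ x).
Definition comul_unit x : law := Δ x ∘ η x ≡ η x ⊗ η x.
Definition counit_unit x : law := ε x ∘ η x ≡ Id [].

Definition τ_mul_l x y : law :=
  τ x y ∘ (m x ⊗ y) ≡ (y ⊗ m x) ∘ (τ x y ⊗ x) ∘ (x ⊗ τ x y).
Definition τ_unit_l x y : law := τ x y ∘ (η x ⊗ y) ≡ y ⊗ η x.
Definition τ_mul_r x y : law :=
  τ x y ∘ (x ⊗ m y) ≡ (m y ⊗ x) ∘ (y ⊗ τ x y) ∘ (τ x y ⊗ y).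
Definition τ_unit_r x y : law := τ x y ∘ (x ⊗ η y) ≡ η y ⊗ x.
Definition τ_comul_r x y : law :=
  (Δ y ⊗ x) ∘ τ x y ≡ (y ⊗ τ x y) ∘ (τ x y ⊗ y) ∘ (x ⊗ Δ y).
Definition τ_comul_l x y : law :=
  (y ⊗ Δ x) ∘ τ x y ≡ (τ x y ⊗ x) ∘ (x ⊗ τ x y) ∘ (Δ x ⊗ y).
Definition τ_counit_l x y : law := (y ⊗ ε x) ∘ τ x y ≡ ε x ⊗ y.

Definition psi : term := (lact ⊗ ract) ∘ (B ⊗ τ B F ⊗ F) ∘ (Δ B ⊗ Δ F).
Definition psi1 : term := (lact ⊗ B) ∘ (B ⊗ τ B F) ∘ (Δ B ⊗ F).
Definition psi2 : term := (F ⊗ ract) ∘ (τ B F ⊗ F) ∘ (B ⊗ Δ F).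
Definition mu : term := (m F ⊗ cocycle) ∘ (F ⊗ τ F F ⊗ F) ∘ (Δ F ⊗ Δ F).
Definition eta : term := η F ⊗ η B.

Definition lact_mul : law := lact ∘ (m B ⊗ F) ≡ lact ∘ (B ⊗ lact).
Definition lact_unit : law := lact ∘ (η B ⊗ F) ≡ F.
Definition lact_trivial : law := lact ≡ ε B ⊗ F.
Definition lact_mul_F p : law :=
  m F ∘ (F ⊗ lact) ∘ (p ⊗ F) ≡ lact ∘ (B ⊗ m F).
Definition lact_unit_F : law := lact ∘ (B ⊗ η F) ≡ η F ∘ ε B.
Definition τ_lact : law :=
  τ B F ∘ (B ⊗ lact) ≡ (lact ⊗ B) ∘ (B ⊗ τ B F) ∘ (τ B B ⊗ F).
Definition lact_assoc : law := m F ∘ (F ⊗ m F) ≡ m F ∘ (F ⊗ lact) ∘ (mu ⊗ F).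
Definition lact_eta : law := m F ∘ (F ⊗ lact) ∘ (eta ⊗ F) ≡ F.

Definition ract_mul p : law :=
  m B ∘ (ract ⊗ B) ∘ (B ⊗ p) ≡ ract ∘ (m B ⊗ F).
Definition ract_unit : law := ract ∘ (η B ⊗ F) ≡ η B ∘ ε F.
Definition ract_unit_F : law := ract ∘ (B ⊗ η F) ≡ B.
Definition ract_trivial : law := ract ≡ B ⊗ ε F.
Definition ract_eta : law :=
  m B ∘ (ε F ⊗ Id [B; B]) ∘ (eta ⊗ B) ≡ m B ∘ (ract ⊗ B) ∘ (B ⊗ eta).
Definition τ_ract : law :=
  τ B F ∘ (ract ⊗ F) ≡ (F ⊗ ract) ∘ (τ B F ⊗ F) ∘ (B ⊗ τ F F).

Definition cocycle_psi p : law :=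
  m B ∘ (cocycle ⊗ B) ∘ (F ⊗ p) ∘ (p ⊗ F) ≡ m B ∘ (ract ⊗ B) ∘ (B ⊗ mu).
Definition cocycle_mu p : law :=
  m B ∘ (cocycle ⊗ B) ∘ (F ⊗ mu) ≡ m B ∘ (cocycle ⊗ B) ∘ (F ⊗ p) ∘ (mu ⊗ F).
Definition cocycle_eta_l p : law :=
  m B ∘ (cocycle ⊗ B) ∘ (F ⊗ p) ∘ (eta ⊗ F) ≡ η B ∘ ε F.
Definition cocycle_eta_r : law := m B ∘ (cocycle ⊗ B) ∘ (F ⊗ eta) ≡ η B ∘ ε F.
Definition cocycle_unit_l : law := cocycle ∘ (η F ⊗ F) ≡ η B ∘ ε F.
Definition cocycle_unit_r : law := cocycle ∘ (F ⊗ η F) ≡ η B ∘ ε F.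
Definition cocycle_trivial : law := cocycle ≡ η B ∘ (ε F ⊗ ε F).
Definition counit_cocycle : law := ε B ∘ cocycle ≡ ε F ⊗ ε F.
Definition τ_cocycle : law :=
  τ B F ∘ (cocycle ⊗ F) ≡ (F ⊗ cocycle) ∘ (τ F F ⊗ F) ∘ (F ⊗ τ F F).

Definition yang_baxter_B : law :=
  (F ⊗ τ B F) ∘ (τ B F ⊗ F) ∘ (B ⊗ τ F F)
  ≡ (τ F F ⊗ B) ∘ (F ⊗ τ B F) ∘ (τ B F ⊗ F).
Definition yang_baxter_F : law :=
  (F ⊗ τ F F) ∘ (τ F F ⊗ F) ∘ (F ⊗ τ F F)
  ≡ (τ F F ⊗ F) ∘ (F ⊗ τ F F) ∘ (τ F F ⊗ F).

Definition wreath_laws (p μ : term) : list law := [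
  p ∘ (m B ⊗ F) ≡ (F ⊗ m B) ∘ (p ⊗ B) ∘ (B ⊗ p);
  p ∘ (η B ⊗ F) ≡ F ⊗ η B;
  (F ⊗ m B) ∘ (μ ⊗ B) ∘ (F ⊗ p) ∘ (p ⊗ F) ≡ (F ⊗ m B) ∘ (p ⊗ B) ∘ (B ⊗ μ);
  (F ⊗ m B) ∘ (eta ⊗ B) ≡ (F ⊗ m B) ∘ (p ⊗ B) ∘ (B ⊗ eta);
  (F ⊗ m B) ∘ (μ ⊗ B) ∘ (F ⊗ μ) ≡ (F ⊗ m B) ∘ (μ ⊗ B) ∘ (F ⊗ p) ∘ (μ ⊗ F);
  (F ⊗ m B) ∘ (μ ⊗ B) ∘ (F ⊗ p) ∘ (eta ⊗ F) ≡ F ⊗ η B;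
  (F ⊗ m B) ∘ (μ ⊗ B) ∘ (F ⊗ eta) ≡ F ⊗ η B].

(* Read from left to right, these laws move comultiplications up and multiplications down. *)
Definition structural_laws : list law := [
  unit_l B; unit_r B; unit_r F;
  comul_unit B; counit_unit B; comul_unit F; counit_unit F;
  τ_mul_l B F; τ_unit_l B F; τ_mul_r B F; τ_unit_r B F; τ_comul_l B F; τ_comul_r B F;
  τ_mul_l F F; τ_unit_l F F; τ_mul_r F F; τ_comul_l F F; τ_counit_l F F; τ_comul_r F F].

Definition datum_laws : list law := structural_laws ++ [lact_assoc; lact_eta].

(** The special laws that can be iterated from left to right along with the structural ones. The
    others are applied once at a chosen point, or reversed. *)
Definition special_expansions1 : list law := [
  lact_mul; lact_unit; lact_unit_F; τ_lact;
  ract_trivial; cocycle_trivial; coassoc B; comul_mul B].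

Definition special_laws1 : list law :=
  [psi ≡ psi1; lact_mul_F psi1; ract_mul psi1] ++ special_expansions1.

Definition special_expansions2 : list law := [
  lact_trivial; ract_unit; τ_ract; counit_cocycle; τ_cocycle;
  coassoc F; counit_r F; comul_mul F].

Definition special_laws2 : list law := [
  ract_mul psi2; ract_eta; cocycle_psi psi2; cocycle_mu psi2;
  cocycle_eta_l psi2; cocycle_eta_r; yang_baxter_B; yang_baxter_F]
  ++ special_expansions2.

Definition laws1 : list law := special_laws1 ++ datum_laws.
Definition laws2 : list law := special_laws2 ++ datum_laws.
Definition expansions1 : list law := structural_laws ++ special_expansions1.
Definition expansions2 : list law := structural_laws ++ special_expansions2.

Definition derived1 : list law := [counit_r F; counit_l B; unit_l F; assoc F].
Definition derived2 : list law :=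
  [ract_unit_F; cocycle_unit_l; cocycle_unit_r; unit_l F; assoc F].

Local Notation once r := (1, [r]).
(** The number 100 stands for as often as possible; reaching the bound could only make the final
    comparison fail. *)
Local Notation all rs := (100, rs).

Ltac by_join T ps qs :=
  apply (holds_of_join _ T ps qs); [assumption | vm_compute; reflexivity].
Ltac by_peak T t0 ps qs :=
  apply (holds_of_peak _ T t0 ps qs); [assumption | vm_compute; reflexivity].

Lemma derived1_hold (M : Model) :
  Forall (holds M) laws1 -> Forall (holds M) (derived1 ++ laws1).
Proof.
intros h1.
assert (h2 : Forall (holds M) (counit_r F :: laws1)).
{ constructor; [|assumption].
  (* For trivial [r], expanding [psi] on [η B] leaves [(F ⊗ ε F) ∘ Δ F], whereas [psi1] leaves the
     identity of [F]. *)
  by_peak laws1 ((F ⊗ ε B) ∘ psi ∘ (η B ⊗ F))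
    [all expansions1] [once (psi ≡ psi1); all expansions1]. }
apply Forall_app; split; [|assumption].
repeat apply Forall_cons; try apply Forall_nil.
- now apply Forall_inv in h2.
(* Direct expansion turns [lact] on [η F] into [η F ∘ ε B] and yields [(ε B ⊗ B) ∘ Δ B]; by
   [ract_mul] the same diagram is [ract ∘ (B ⊗ η F)], the identity of [B]. *)
- by_peak laws1 (m B ∘ (ract ⊗ B) ∘ (B ⊗ psi1) ∘ (η B ⊗ B ⊗ η F))
    [all expansions1] [once (ract_mul psi1); all expansions1].
- by_peak (counit_r F :: laws1) (m F ∘ (F ⊗ lact) ∘ (eta ⊗ F))
    [all expansions1] [once lact_eta].
(* The counit law collapses [mu] to [m F ⊗ η B], after which [lact_unit] removes the action: twisted
   associativity becomes associativity. *)
- by_peak (counit_r F :: laws1) (m F ∘ (F ⊗ m F))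
    [once lact_assoc; all (counit_r F :: expansions1)] (@nil step).
Qed.

Lemma wreath_laws1 (M : Model) : Forall (holds M) laws1 ->
  holds M (mu ≡ m F ⊗ η B) /\ Forall (holds M) (wreath_laws psi1 mu).
Proof.
intros h%derived1_hold; split.
- by_join (derived1 ++ laws1) [all (derived1 ++ expansions1)] (@nil step).
- repeat apply Forall_cons; try apply Forall_nil.
  (* Reversed, [lact_mul_F] carries [m F] below [lact], in agreement with the orientation of all
     other laws. *)
  all: by_join (derived1 ++ laws1)
    [all (flip (lact_mul_F psi1) :: derived1 ++ expansions1)]
    [all (flip (lact_mul_F psi1) :: derived1 ++ expansions1)].
Qed.

(** The unit conditions of the datum carry an extra factor [m B] with a unit at one input; removing
    it gives the bare normalisations of [ract] and [cocycle]. *)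
Lemma derived2_hold (M : Model) :
  Forall (holds M) laws2 -> Forall (holds M) (derived2 ++ laws2).
Proof.
intros h; apply Forall_app; split; [|assumption].
repeat apply Forall_cons; try apply Forall_nil.
- by_peak laws2 (m B ∘ (ract ⊗ B) ∘ (B ⊗ eta))
    [all expansions2] [once (flip ract_eta); all expansions2].
- by_peak laws2 (m B ∘ (cocycle ⊗ B) ∘ (F ⊗ psi2) ∘ (eta ⊗ F))
    [all expansions2] [once (cocycle_eta_l psi2)].
- by_peak laws2 (m B ∘ (cocycle ⊗ B) ∘ (F ⊗ eta))
    [all expansions2] [once cocycle_eta_r].
- by_peak laws2 (m F ∘ (F ⊗ lact) ∘ (eta ⊗ F)) [all expansions2] [once lact_eta].
(* The trivial action puts [ε B] on the output of [cocycle]; by [counit_cocycle] and the counit law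
   of [F], only [m F] is left of [mu]. *)
- by_peak laws2 (m F ∘ (F ⊗ m F)) [once lact_assoc; all expansions2] (@nil step).
Qed.

Lemma wreath_laws2 (M : Model) :
  Forall (holds M) laws2 -> Forall (holds M) (wreath_laws psi2 mu).
Proof.
intros h%derived2_hold.
set (T := derived2 ++ laws2) in h.
set (expand := all (derived2 ++ expansions2)).
repeat apply Forall_cons; try apply Forall_nil.
(* Expansion brings [m B] to the first input of [ract], where the reversed law splits it into two
   actions linked by [psi2]. *)
- by_join T [expand; once (flip (ract_mul psi2)); expand] [expand].
- by_join T [expand] [expand].
(* On the right side, expansion has moved both comultiplications above the crossings. Moving one
   back below its crossing restores a copy of [mu] under [ract], to which [cocycle_psi] applies;
   Yang-Baxter then aligns the crossings of one wire [B] with two wires [F]. *)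
- by_join T [expand; once (flip yang_baxter_B)]
    [expand; once (flip (τ_comul_l F F)); once (flip (cocycle_psi psi2)); expand].
- by_join T [expand] [expand].
(* The same device: a copy of [mu] is restored below [cocycle] so that the cocycle identity applies,
   and the remaining difference is a Yang-Baxter move of three wires [F]. *)
- by_join T [expand; once (flip (τ_comul_l F F)); once (cocycle_mu psi2); expand;
    once yang_baxter_F] [expand].
- by_join T [expand] [expand].
- by_join T [expand] [expand].
Qed.

End Laws.

(** * Models from Hopf data *)

Section Models.
Context {K : TwoCategory} {A : K} {X Y : cell1 A A}.

Definition letter_of (P Q : cell1 A A) (x : color) : cell1 A A :=
  match x with B => P | F => Q end.

Definition monad_value (D : MonadHopfCells X Y) (g : generator) :
    arr (letter_of X Y) :=
  let a u v := @toarr K A (letter_of X Y) u v in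
  match g with
  | m B => a [B; B] [B] (mB D) | m F => a [F; F] [F] (mF D)
  | η B => a [] [B] (ηB D) | η F => a [] [F] (ηF D)
  | Δ B => a [B] [B; B] (ΔB D) | Δ F => a [F] [F; F] (ΔF D)
  | ε B => a [B] [] (εB D) | ε F => a [F] [] (εF D)
  | τ B B => a [B; B] [B; B] (τBB D) | τ B F => a [B; F] [F; B] (τBF D)
  | τ F B => a [F; B] [B; F] (τFB D) | τ F F => a [F; F] [F; F] (τFF D)
  | lact => a [B; F] [F] (l D) | ract => a [B; F] [B] (r D)
  | cocycle => a [F; F] [B] (σ D)
  end.

Definition monad_model (D : MonadHopfCells X Y) : Model.
Proof.
refine {| carrier := words_monoidal (letter_of X Y);
  value_generator := monad_value D |}.
all: now intros [[|]|[|]|[|]|[|]|[|] [|]| | |].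
Defined.

(* The wires [B] and [F] stand for the 1-cells [F = Y] and [B = X] of the comonad datum. *)
Definition comonad_value (D : ComonadHopfCells X Y) (g : generator) :
    arr (letter_of Y X) :=
  let a u v := @toarr K A (letter_of Y X) u v in
  match g with
  | m B => a [B] [B; B] (ΔF D) | m F => a [F] [F; F] (ΔB D)
  | η B => a [B] [] (εF D) | η F => a [F] [] (εB D)
  | Δ B => a [B; B] [B] (mF D) | Δ F => a [F; F] [F] (mB D)
  | ε B => a [] [B] (ηF D) | ε F => a [] [F] (ηB D)
  | τ B B => a [B; B] [B; B] (τFF D) | τ B F => a [B; F] [F; B] (τFB D)
  | τ F B => a [F; B] [B; F] (τBF D) | τ F F => a [F; F] [F; F] (τBB D)
  | lact => a [F] [F; B] (c D) | ract => a [B] [F; B] (d D)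
  | cocycle => a [B] [F; F] (ρ' D)
  end.

Definition comonad_model (D : ComonadHopfCells X Y) : Model.
Proof.
refine {| carrier := opposite (words_monoidal (letter_of Y X));
  value_generator := comonad_value D |}.
all: now intros [[|]|[|]|[|]|[|]|[|] [|]| | |].
Defined.
End Models.

(** Undoes the reversal of composition and tensor made by [opposite], so that the value of a
    mirrored term computes to the 2-cell it was read from. Generators stay, as they are already
    named by their duals. *)
Fixpoint mirror (t : term) : term :=
  match t with
  | Gen g => g
  | Id w => Id (rev w)
  | Comp s t => Comp (mirror t) (mirror s)
  | Tensor s t => Tensor (mirror t) (mirror s)
  end.

(** * Translation between equations of 2-cells and laws of diagrams *)

Ltac reify_word X w :=
  lazymatch w with
  | nil => constr:(@nil color)
  | cons X ?w => let u := reify_word X w in constr:(B :: u)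
  | cons _ ?w => let u := reify_word X w in constr:(F :: u)
  end.

Ltac reify X generator e :=
  lazymatch e with
  | vert ?g ?f =>
    let s := reify X generator g in let t := reify X generator f in constr:(Comp s t)
  | tens ?f ?g =>
    let s := reify X generator f in let t := reify X generator g in constr:(Tensor s t)
  | idw ?w => let u := reify_word X w in constr:(Id u)
  | _ => let g := generator e in constr:(Gen g)
  end.

Ltac monad_generator e :=
  lazymatch e with
  | mul (onB _) => constr:(m B) | mul (onF _) => constr:(m F)
  | unit (onB _) => constr:(η B) | unit (onF _) => constr:(η F)
  | comul (onB _) => constr:(Δ B) | comul (onF _) => constr:(Δ F)
  | counit (onB _) => constr:(ε B) | counit (onF _) => constr:(ε F)
  | τBB _ => constr:(τ B B) | τBF _ => constr:(τ B F)
  | τFB _ => constr:(τ F B) | τFF _ => constr:(τ F F)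
  | l _ => lact | r _ => ract | σ _ => cocycle
  end.

Ltac comonad_generator e :=
  lazymatch e with
  | mul (onB _) => constr:(Δ F) | mul (onF _) => constr:(Δ B)
  | unit (onB _) => constr:(ε F) | unit (onF _) => constr:(ε B)
  | comul (onB _) => constr:(m F) | comul (onF _) => constr:(m B)
  | counit (onB _) => constr:(η F) | counit (onF _) => constr:(η B)
  | τBB _ => constr:(τ F F) | τBF _ => constr:(τ F B)
  | τFB _ => constr:(τ B F) | τFF _ => constr:(τ B B)
  | c _ => lact | d _ => ract | ρ' _ => cocycle
  end.

(* Calls [k] on the terms of the two sides of the equation [e] between 2-cells, and on the
   injection into arrows of the hom-set in which it lives. *)
Ltac reify_equation M e k :=
  let e := eval unfold ψ, ψ1, ψ2, μM, ηM, φ', φ'1, φ'2, ΔC', εC' in e in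
  lazymatch e with @eq (@cell ?K ?A ?u ?v) ?e1 ?e2 =>
  let u := eval cbn in u in let v := eval cbn in v in
  lazymatch M with
  | @monad_model _ _ ?X ?Y _ =>
    let s := reify X monad_generator e1 in let t := reify X monad_generator e2 in
    let u := reify_word X u in let v := reify_word X v in
    k s t (letter_of X Y) u v
  | @comonad_model _ _ ?X ?Y _ =>
    let s := reify Y comonad_generator e1 in let t := reify Y comonad_generator e2 in
    let u := reify_word Y u in let v := reify_word Y v in
    k (mirror s) (mirror t) (letter_of Y X) u v
  end end.

(** The middle equality typechecks by conversion alone: on concrete words [value] computes to the
    given 2-cell wrapped in [toarr]. The outer two are instances of [coherence]. *)
Ltac law_from H :=
  lazymatch goal with |- holds ?M ?p =>
  let e := type of H in
  reify_equation M e ltac:(fun s t letter u v =>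
    refine (eq_trans (coherence M (fst p) s _) (eq_trans
      (f_equal (@toarr _ _ letter u v) H) (coherence M t (snd p) _))))
  end; vm_compute; reflexivity.

Ltac equation_from H :=
  lazymatch type of H with holds ?M ?p =>
  lazymatch goal with |- ?e =>
  reify_equation M e ltac:(fun s t letter u v =>
    refine (toarr_inj letter u v _ _ (eq_trans (coherence M s (fst p) _)
      (eq_trans H (coherence M (snd p) t _)))))
  end end; vm_compute; reflexivity.

Ltac split_conjunctions :=
  repeat match goal with h : _ /\ _ |- _ => destruct h end.

(** No table pairs laws with hypotheses: every equation in the context is tried in both directions,
    and [coherence] accepts only one that matches. *)
Ltac laws_from_hypotheses :=
  repeat apply Forall_cons; try apply Forall_nil;
  first [ match goal with H : _ = _ |- _ => solve [law_from H] end
        | match goal with H : _ = _ |- _ => solve [law_from (eq_sym H)] end ].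

Ltac equations_from_laws :=
  repeat apply conj;
  first [ match goal with H : holds _ _ |- _ => solve [equation_from H] end
        | symmetry; match goal with H : holds _ _ |- _ => solve [equation_from H] end ].

Section Datum.
Context {K : TwoCategory} {A : K} {X Y : cell1 A A}.

Lemma monad_datum_laws (D : MonadHopfCells X Y) : is_monad_Hopf_datum D ->
  Forall (holds (monad_model D)) datum_laws.
Proof.
intros []; unfold all_distributive, is_distributive_law, is_monad, is_prebimonad in *.
split_conjunctions; laws_from_hypotheses.
Qed.

Lemma comonad_datum_laws (D : ComonadHopfCells X Y) : is_comonad_Hopf_datum D ->
  Forall (holds (comonad_model D)) datum_laws.
Proof.
intros []; unfold all_distributive, is_distributive_law, is_comonad, is_prebimonad in *.
split_conjunctions; laws_from_hypotheses.
Qed.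
End Datum.

Theorem proposition4p16 :
  forall (K : TwoCategory) (A : K) (B F : cell1 A A),
  (forall D : MonadHopfCells B F,
     is_monad_Hopf_datum D ->
     r_trivial D -> ψ D = ψ1 D -> σ_trivial D ->
     (ΔB D ⊗ idw [B]) ∘ ΔB D = (idw [B] ⊗ ΔB D) ∘ ΔB D ->
     ΔB D ∘ mB D
       = (mB D ⊗ mB D) ∘ (idw [B] ⊗ τBB D ⊗ idw [B]) ∘ (ΔB D ⊗ ΔB D) ->
     τBF D ∘ (idw [B] ⊗ l D)
       = (l D ⊗ idw [B]) ∘ (idw [B] ⊗ τBF D) ∘ (τBB D ⊗ idw [F]) ->
     μM D = mF D ⊗ ηB D
     /\ is_left_wreath (mB D) (ηB D) (ψ1 D) (μM D) (ηM D))
  /\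
  (forall D : MonadHopfCells B F,
     is_monad_Hopf_datum D ->
     l_trivial D -> ψ D = ψ2 D ->
     is_comonad (ΔF D) (εF D) ->
     ΔF D ∘ mF D
       = (mF D ⊗ mF D) ∘ (idw [F] ⊗ τFF D ⊗ idw [F]) ∘ (ΔF D ⊗ ΔF D) ->
     (idw [F] ⊗ τBF D) ∘ (τBF D ⊗ idw [F]) ∘ (idw [B] ⊗ τFF D)
       = (τFF D ⊗ idw [B]) ∘ (idw [F] ⊗ τBF D) ∘ (τBF D ⊗ idw [F]) ->
     τBF D ∘ (r D ⊗ idw [F])
       = (idw [F] ⊗ r D) ∘ (τBF D ⊗ idw [F]) ∘ (idw [B] ⊗ τFF D) ->
     (idw [F] ⊗ τFF D) ∘ (τFF D ⊗ idw [F]) ∘ (idw [F] ⊗ τFF D)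
       = (τFF D ⊗ idw [F]) ∘ (idw [F] ⊗ τFF D) ∘ (τFF D ⊗ idw [F]) ->
     τBF D ∘ (σ D ⊗ idw [F])
       = (idw [F] ⊗ σ D) ∘ (τFF D ⊗ idw [F]) ∘ (idw [F] ⊗ τFF D) ->
     is_left_wreath (mB D) (ηB D) (ψ2 D) (μM D) (ηM D))
  /\
  (forall D : ComonadHopfCells B F,
     is_comonad_Hopf_datum D ->
     d_trivial D -> φ' D = φ'1 D -> ρ'_trivial D ->
     mF D ∘ (mF D ⊗ idw [F]) = mF D ∘ (idw [F] ⊗ mF D) ->
     ΔF D ∘ mF D
       = (mF D ⊗ mF D) ∘ (idw [F] ⊗ τFF D ⊗ idw [F]) ∘ (ΔF D ⊗ ΔF D) ->
     (c D ⊗ idw [F]) ∘ τFB D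
       = (idw [B] ⊗ τFF D) ∘ (τFB D ⊗ idw [F]) ∘ (idw [F] ⊗ c D) ->
     ΔC' D = εF D ⊗ ΔB D
     /\ is_right_cowreath (ΔF D) (εF D) (φ'1 D) (ΔC' D) (εC' D))
  /\
  (forall D : ComonadHopfCells B F,
     is_comonad_Hopf_datum D ->
     c_trivial D -> φ' D = φ'2 D ->
     is_monad (mB D) (ηB D) ->
     ΔB D ∘ mB D
       = (mB D ⊗ mB D) ∘ (idw [B] ⊗ τBB D ⊗ idw [B]) ∘ (ΔB D ⊗ ΔB D) ->
     (τBB D ⊗ idw [F]) ∘ (idw [B] ⊗ τFB D) ∘ (τFB D ⊗ idw [B])
       = (idw [B] ⊗ τFB D) ∘ (τFB D ⊗ idw [B]) ∘ (idw [F] ⊗ τBB D) ->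
     (idw [B] ⊗ d D) ∘ τFB D
       = (τBB D ⊗ idw [F]) ∘ (idw [B] ⊗ τFB D) ∘ (d D ⊗ idw [B]) ->
     (idw [B] ⊗ τBB D) ∘ (τBB D ⊗ idw [B]) ∘ (idw [B] ⊗ τBB D)
       = (τBB D ⊗ idw [B]) ∘ (idw [B] ⊗ τBB D) ∘ (τBB D ⊗ idw [B]) ->
     (idw [B] ⊗ ρ' D) ∘ τFB D
       = (τBB D ⊗ idw [B]) ∘ (idw [B] ⊗ τBB D) ∘ (ρ' D ⊗ idw [B]) ->
     is_right_cowreath (ΔF D) (εF D) (φ'2 D) (ΔC' D) (εC' D)).
Proof.
intros K A B F; split; [|split; [|split]].
- intros D H hr hψ hσ hΔ hmΔ hτ.
  assert (h : Forall (holds (monad_model D)) laws1).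
  { apply Forall_app; split; [|now apply monad_datum_laws].
    (* These two conditions become [lact_mul_F psi1] and [ract_mul psi1]; the replacement has to
       precede reification, which unfolds [ψ]. *)
    destruct H; rewrite hψ in mhd_l_mF, mhd_r_mB.
    unfold is_left_module, r_trivial, σ_trivial in *.
    split_conjunctions; laws_from_hypotheses. }
  apply wreath_laws1 in h as [hμ h]; unfold wreath_laws in h.
  rewrite !Forall_cons_iff in h; split_conjunctions.
  unfold is_left_wreath; equations_from_laws.
- intros D H hl hψ hF hmΔ hyb hr hyb' hσ.
  assert (h : Forall (holds (monad_model D)) laws2).
  { apply Forall_app; split; [|now apply monad_datum_laws].
    destruct H; rewrite hψ in mhd_r_mB, mhd_σ_ψ, mhd_σ_cocycle, mhd_σ_unitl.
    unfold is_comonad, l_trivial in *.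
    split_conjunctions; laws_from_hypotheses. }
  apply wreath_laws2 in h; unfold wreath_laws in h.
  rewrite !Forall_cons_iff in h; split_conjunctions.
  unfold is_left_wreath; equations_from_laws.
- intros D H hd hφ hρ hm hmΔ hτ.
  assert (h : Forall (holds (comonad_model D)) laws1).
  { apply Forall_app; split; [|now apply comonad_datum_laws].
    (* Under the reversal these are again [lact_mul_F psi1] and [ract_mul psi1], with [c] read as
       [lact] and [d] as [ract]. *)
    destruct H; rewrite hφ in chd_c_ΔB, chd_d_ΔF.
    unfold is_right_comodule, d_trivial, ρ'_trivial in *.
    split_conjunctions; laws_from_hypotheses. }
  apply wreath_laws1 in h as [hμ h]; unfold wreath_laws in h.
  rewrite !Forall_cons_iff in h; split_conjunctions.
  unfold is_right_cowreath; equations_from_laws.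
- intros D H hc hφ hB hmΔ hyb hd hyb' hρ.
  assert (h : Forall (holds (comonad_model D)) laws2).
  { apply Forall_app; split; [|now apply comonad_datum_laws].
    destruct H; rewrite hφ in chd_d_ΔF, chd_ρ_φ, chd_ρ_cocycle, chd_ρ_counitr.
    unfold is_monad, c_trivial in *.
    split_conjunctions; laws_from_hypotheses. }
  apply wreath_laws2 in h; unfold wreath_laws in h.
  rewrite !Forall_cons_iff in h; split_conjunctions.
  unfold is_right_cowreath; equations_from_laws.
Qed.
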